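(* Let $k$ be a field, let $\mathcal D=\mathrm{Ch}^b(\mathrm{vect}_k)$ be the abelian category of bounded cochain complexes of finite-dimensional $k$-vector spaces, and for $X\in\mathcal D$ put $\beta(X)=\sum_{n\in\mathbb Z}\dim_k H^n(X)$. Let $\mathcal A$ be the full subcategory of $\mathcal D$ with objects $$\mathcal A=\{X\in\mathcal D:\beta(X)\in 2\mathbb Z\},$$ with conflations the short exact sequences of $\mathcal D$ all of whose terms lie in $\mathcal A$. Define the classes of objects $$\mathcal F=\{X\in\mathcal A: H^n(X)=0\text{ for all }n\ge 1\},\qquad \mathcal C=\{X\in\mathcal A: H^n(X)=0\text{ for all }n\le 1\}.$$ Then $\mathcal A$ is a Hom-finite, weakly idempotent complete Frobenius exact category that is not idempotent complete. The pair $(\langle\mathcal F\rangle,\langle\mathcal C\rangle)$ is a complete ideal cotorsion pair of object ideals in $\mathcal A$, with $\mathrm{Ob}(\langle\mathcal F\rangle)=\mathcal F$ and $\mathrm{Ob}(\langle\mathcal C\rangle)=\mathcal C$. The cotorsion pair of objects $(\mathcal F,\mathcal C)$ in $\mathcal A$ is neither special precovering nor special preenveloping. In fact, the object $$M=S^0(k)\oplus S^2(k)\in\mathcal A$$ has neither a special $\mathcal F$-precover nor a special $\mathcal C$-preenvelope.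
   Context: $S^r(V)$ denotes the stalk complex with the vector space $V$ in degree $r$ and zero elsewhere. Exact categories are in the sense of Quillen; $\mathrm{Ext}^1_{\mathcal A}$ is the Yoneda extension bifunctor of the exact category $\mathcal A$. A Frobenius exact category is one with enough projectives and enough injectives in which projective and injective objects coincide. A category is weakly idempotent complete if every split monomorphism has a cokernel (equivalently every retraction has a kernel), and idempotent complete if every idempotent endomorphism splits. An ideal $\mathcal I$ of $\mathcal A$ is a class of morphisms that is an additive subbifunctor of $\mathrm{Hom}_{\mathcal A}(-,-)$ (closed under addition and under composition with arbitrary morphisms on either side). For an additive class of objects $\mathcal X$, $\langle\mathcal X\rangle$ is the ideal of morphisms factoring through an object of $\mathcal X$. For an ideal $\mathcal I$, $\mathrm{Ob}(\mathcal I)=\{X\in\mathcal A:1_X\in\mathcal I\}$; $\mathcal I$ is an object ideal if $\mathcal I=\langle\mathrm{Ob}(\mathcal I)\rangle$. For morphisms $f:X_0\to X_1$, $g:Y_0\to Y_1$, the map $\mathrm{Ext}^1_{\mathcal A}(f,g):\mathrm{Ext}^1_{\mathcal A}(X_1,Y_0)\to\mathrm{Ext}^1_{\mathcal A}(X_0,Y_1)$ is pullback along $f$ followed by pushout along $g$. For ideals $\mathcal I,\mathcal J$ put ${}^\perp\mathcal J=\{f:\mathrm{Ext}^1_{\mathcal A}(f,g)=0\ \forall g\in\mathcal J\}$ and $\mathcal I^\perp=\{g:\mathrm{Ext}^1_{\mathcal A}(f,g)=0\ \forall f\in\mathcal I\}$. $(\mathcal I,\mathcal J)$ is an ideal cotorsion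 pair if $\mathcal I={}^\perp\mathcal J$ and $\mathcal J=\mathcal I^\perp$. An $\mathcal I$-precover of $A$ is a morphism $p:E\to A$ in $\mathcal I$ through which every morphism in $\mathcal I$ with codomain $A$ factors. It is special if there are a conflation $0\to Y\to Z\to A\to0$ and a morphism $g:Y\to B$ in $\mathcal I^\perp$ whose pushout conflation is $0\to B\to E\xrightarrow{p}A\to0$. Dually, a $\mathcal J$-preenvelope of $A$ is a morphism $A\to D$ in $\mathcal J$ through which every morphism in $\mathcal J$ with domain $A$ factors; it is special if it is the inflation in a conflation obtained as the pullback of a conflation $0\to A\to Z\to Y\to 0$ along a morphism $B\to Y$ in ${}^\perp\mathcal J$. The ideal cotorsion pair $(\mathcal I,\mathcal J)$ is complete if every object has a special $\mathcal I$-precover and a special $\mathcal J$-preenvelope. For classes of objects, $(\mathcal F,\mathcal C)$ is a cotorsion pair if $\mathcal F=\{X:\mathrm{Ext}^1_{\mathcal A}(X,C)=0\ \forall C\in\mathcal C\}$ and $\mathcal C=\{Y:\mathrm{Ext}^1_{\mathcal A}(F,Y)=0\ \forall F\in\mathcal F\}$. A special $\mathcal F$-precover of $A$ is a conflation $0\to C\to F\to A\to0$ with $F\in\mathcal F$, $C\in\mathcal C$; a special $\mathcal C$-preenvelope of $A$ is a conflation $0\to A\to C\to F\to0$ with $C\in\mathcal C$, $F\in\mathcal F$. The pair is special precovering (resp. special preenveloping) if every object has a special $\mathcal F$-precover (resp. special $\mathcal C$-preenvelope). *)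

(* Defs.v *)
From HB Require Import structures.
From mathcomp Require Import all_boot all_order all_algebra.
From mathcomp Require Import boolp classical_sets fsbigop.

Set Implicit Arguments.
Unset Strict Implicit.
Unset Printing Implicit Defensive.

Import GRing.Theory.
Local Open Scope ring_scope.

Record lincat (k : fieldType) := LinCat {
  obj :> Type;
  hom : obj -> obj -> lmodType k;
  idm : forall X : obj, hom X X;
  comp : forall X Y Z : obj, hom Y Z -> hom X Y -> hom X Z;
  comp_idl : forall (X Y : obj) (f : hom X Y), comp (idm Y) f = f;
  comp_idr : forall (X Y : obj) (f : hom X Y), comp f (idm X) = f;
  comp_assoc : forall (W X Y Z : obj) (h : hom Y Z) (g : hom X Y) (f : hom W X),
    comp h (comp g f) = comp (comp h g) f;
  comp_linl : forall (X Y Z : obj) (a : k) (g g' : hom Y Z) (f : hom X Y),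
    comp (a *: g + g') f = a *: comp g f + comp g' f;
  comp_linr : forall (X Y Z : obj) (a : k) (g : hom Y Z) (f f' : hom X Y),
    comp g (a *: f + f') = a *: comp g f + comp g f'
}.

Arguments hom {k} l X Y : rename.
Arguments idm {k l} X : rename.
Arguments comp {k l X Y Z} g f : rename.

Notation "g \oc f" := (comp g f) (at level 40, left associativity).

Definition full_subcat (k : fieldType) (D : lincat k) (P : D -> Prop) :
    lincat k :=
  @LinCat k {X : D | P X} (fun X Y => hom D (sval X) (sval Y))
    (fun X => idm (sval X)) (fun X Y Z g f => g \oc f)
    (fun X Y f => comp_idl f) (fun X Y f => comp_idr f)
    (fun W X Y Z h g f => comp_assoc h g f)
    (fun X Y Z a g g' f => comp_linl a g g' f)
    (fun X Y Z a g f f' => comp_linr a g f f').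

Section Categories.
Variables (k : fieldType) (A : lincat k).

Definition is_iso (X Y : A) (f : hom A X Y) : Prop :=
  exists g : hom A Y X, g \oc f = idm X /\ f \oc g = idm Y.

Definition is_kernel (X Y Z : A) (i : hom A X Y) (p : hom A Y Z) : Prop :=
  p \oc i = 0 /\
  forall (W : A) (h : hom A W Y), p \oc h = 0 ->
    exists! u : hom A W X, i \oc u = h.

Definition is_cokernel (X Y Z : A) (i : hom A X Y) (p : hom A Y Z) : Prop :=
  p \oc i = 0 /\
  forall (W : A) (h : hom A Y W), h \oc i = 0 ->
    exists! u : hom A Z W, u \oc p = h.

(** The square [f \oc q = p \oc g] with corner [P] is cartesian:
    [[
      P --g--> Y
      |q       |p
      X --f--> Z
    ]] *)
Definition is_pullback (P X Y Z : A) (q : hom A P X) (g : hom A P Y)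
    (f : hom A X Z) (p : hom A Y Z) : Prop :=
  f \oc q = p \oc g /\
  forall (W : A) (a : hom A W X) (b : hom A W Y), f \oc a = p \oc b ->
    exists! u : hom A W P, q \oc u = a /\ g \oc u = b.

(** The square [q \oc f = g \oc i] with corner [P] is cocartesian:
    [[
      Z --i--> Y
      |f       |g
      X --q--> P
    ]] *)
Definition is_pushout (Z X Y P : A) (f : hom A Z X) (i : hom A Z Y)
    (q : hom A X P) (g : hom A Y P) : Prop :=
  q \oc f = g \oc i /\
  forall (W : A) (a : hom A X W) (b : hom A Y W), a \oc f = b \oc i ->
    exists! u : hom A P W, u \oc q = a /\ u \oc g = b.

Definition is_biproduct (X Y B : A) (iX : hom A X B) (iY : hom A Y B)
    (pX : hom A B X) (pY : hom A B Y) : Prop :=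
  [/\ pX \oc iX = idm X, pY \oc iY = idm Y, pY \oc iX = 0, pX \oc iY = 0
    & iX \oc pX + iY \oc pY = idm B].

Definition is_additive : Prop :=
  (exists O : A, idm O = 0) /\
  (forall X Y : A, exists (B : A) (iX : hom A X B) (iY : hom A Y B)
     (pX : hom A B X) (pY : hom A B Y), is_biproduct iX iY pX pY).

Definition hom_finite : Prop :=
  forall X Y : A, exists (n : nat) (phi : hom A X Y -> 'rV[k]_n),
    linear phi /\ bijective phi.

Definition weakly_idempotent_complete : Prop :=
  forall (X Y : A) (s : hom A X Y), (exists r : hom A Y X, r \oc s = idm X) ->
    exists (Z : A) (c : hom A Y Z), is_cokernel s c.

Definition idempotent_complete : Prop :=
  forall (X : A) (e : hom A X X), e \oc e = e ->
    exists (Y : A) (r : hom A X Y) (s : hom A Y X),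
      s \oc r = e /\ r \oc s = idm Y.

End Categories.

Definition conf_class (k : fieldType) (A : lincat k) :=
  forall X Y Z : A, hom A X Y -> hom A Y Z -> Prop.

Section Exact.
Variables (k : fieldType) (A : lincat k) (conf : conf_class A).

Definition inflation (X Y : A) (i : hom A X Y) : Prop :=
  exists (Z : A) (p : hom A Y Z), conf i p.

Definition deflation (Y Z : A) (p : hom A Y Z) : Prop :=
  exists (X : A) (i : hom A X Y), conf i p.

(** Quillen's axioms; the last two (the "obscure" axiom and its dual) are
    known to follow from the others. *)
Record is_exact : Prop := IsExact {
  exact_additive : is_additive A;
  exact_iso : forall (X Y Z X' Y' Z' : A) (i : hom A X Y) (p : hom A Y Z)
    (i' : hom A X' Y') (p' : hom A Y' Z')
    (a : hom A X X') (b : hom A Y Y') (c : hom A Z Z'),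
    is_iso a -> is_iso b -> is_iso c ->
    b \oc i = i' \oc a -> c \oc p = p' \oc b -> conf i p -> conf i' p';
  exact_split : forall (X Y B : A) (iX : hom A X B) (iY : hom A Y B)
    (pX : hom A B X) (pY : hom A B Y), is_biproduct iX iY pX pY -> conf iX pY;
  exact_kercoker : forall (X Y Z : A) (i : hom A X Y) (p : hom A Y Z),
    conf i p -> is_kernel i p /\ is_cokernel i p;
  exact_deflation_comp : forall (X Y Z : A) (p : hom A X Y) (q : hom A Y Z),
    deflation p -> deflation q -> deflation (q \oc p);
  exact_inflation_comp : forall (X Y Z : A) (i : hom A X Y) (j : hom A Y Z),
    inflation i -> inflation j -> inflation (j \oc i);
  exact_pullback : forall (X Y Z : A) (f : hom A X Z) (p : hom A Y Z),
    deflation p -> exists (P : A) (q : hom A P X) (g : hom A P Y),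
      is_pullback q g f p /\ deflation q;
  exact_pushout : forall (X Y Z : A) (f : hom A Z X) (i : hom A Z Y),
    inflation i -> exists (P : A) (q : hom A X P) (g : hom A Y P),
      is_pushout f i q g /\ inflation q;
  exact_obscure : forall (X Y Z : A) (q : hom A X Y) (p : hom A Y Z),
    (exists (K : A) (i : hom A K Y), is_kernel i p) ->
    deflation (p \oc q) -> deflation p;
  exact_obscure_op : forall (X Y Z : A) (i : hom A X Y) (j : hom A Y Z),
    (exists (K : A) (p : hom A Y K), is_cokernel i p) ->
    inflation (j \oc i) -> inflation i
}.

Definition projective (P : A) : Prop :=
  forall (Y Z : A) (p : hom A Y Z) (f : hom A P Z), deflation p ->
    exists g : hom A P Y, p \oc g = f.

Definition injective_obj (I : A) : Prop :=
  forall (X Y : A) (i : hom A X Y) (f : hom A X I), inflation i ->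
    exists g : hom A Y I, g \oc i = f.

Record is_frobenius : Prop := IsFrobenius {
  frobenius_exact : is_exact;
  frobenius_enough_proj : forall X : A, exists (P : A) (p : hom A P X),
    projective P /\ deflation p;
  frobenius_enough_inj : forall X : A, exists (I : A) (i : hom A X I),
    injective_obj I /\ inflation i;
  frobenius_proj_inj : forall X : A, projective X <-> injective_obj X
}.

(** An extension of [X] by [Y], i.e. a conflation [0 -> Y -> E -> X -> 0]
    representing an element of Ext^1(X, Y). *)
Record extension (X Y : A) := Extension {
  ext_mid : A;
  ext_inf : hom A Y ext_mid;
  ext_def : hom A ext_mid X;
  ext_conf : conf ext_inf ext_def
}.

(** The extensions representing the zero element of Ext^1(X, Y). *)
Definition ext_split (X Y : A) (xi : extension X Y) : Prop :=
  exists s : hom A X (ext_mid xi), ext_def xi \oc s = idm X.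

Definition ext_pullback (X0 X1 Y : A) (f : hom A X0 X1)
    (xi : extension X1 Y) (xi' : extension X0 Y) : Prop :=
  exists h : hom A (ext_mid xi') (ext_mid xi),
    is_pullback (ext_def xi') h f (ext_def xi) /\
    h \oc ext_inf xi' = ext_inf xi.

Definition ext_pushout (X Y0 Y1 : A) (g : hom A Y0 Y1)
    (xi : extension X Y0) (xi' : extension X Y1) : Prop :=
  exists h : hom A (ext_mid xi) (ext_mid xi'),
    is_pushout g (ext_inf xi) (ext_inf xi') h /\
    ext_def xi' \oc h = ext_def xi.

(** Ext^1(f, g) as a relation between representatives: the class of [xi] is
    sent to the class of [zeta].  Pullbacks and pushouts are unique up to Yoneda
    equivalence, so no quotient by that equivalence is needed. *)
Definition Ext1_map (X0 X1 Y0 Y1 : A) (f : hom A X0 X1) (g : hom A Y0 Y1)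
    (xi : extension X1 Y0) (zeta : extension X0 Y1) : Prop :=
  exists xi' : extension X0 Y0, ext_pullback f xi xi' /\ ext_pushout g xi' zeta.

Definition Ext1_map_zero (X0 X1 Y0 Y1 : A) (f : hom A X0 X1)
    (g : hom A Y0 Y1) : Prop :=
  forall (xi : extension X1 Y0) (zeta : extension X0 Y1),
    Ext1_map f g xi zeta -> ext_split zeta.

Definition Ext1_zero (X Y : A) : Prop := forall xi : extension X Y, ext_split xi.

Definition mor_class := forall X Y : A, hom A X Y -> Prop.
Definition obj_class := A -> Prop.

Definition mor_class_eq (I J : mor_class) : Prop :=
  forall (X Y : A) (f : hom A X Y), I X Y f <-> J X Y f.

Definition obj_class_eq (F G : obj_class) : Prop :=
  forall X : A, F X <-> G X.

(** Closure under opposites follows, as [- f = (- idm Y) \oc f]. *)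
Record is_ideal (I : mor_class) : Prop := IsIdeal {
  ideal_zero : forall X Y : A, I X Y 0;
  ideal_add : forall (X Y : A) (f g : hom A X Y),
    I X Y f -> I X Y g -> I X Y (f + g);
  ideal_compl : forall (X Y Z : A) (g : hom A Y Z) (f : hom A X Y),
    I X Y f -> I X Z (g \oc f);
  ideal_compr : forall (X Y Z : A) (g : hom A Y Z) (f : hom A X Y),
    I Y Z g -> I X Z (g \oc f)
}.

Definition ideal_gen (F : obj_class) : mor_class := fun X Y f =>
  exists (W : A) (a : hom A X W) (b : hom A W Y), F W /\ b \oc a = f.

Definition Ob (I : mor_class) : obj_class := fun X => I X X (idm X).

Definition is_object_ideal (I : mor_class) : Prop :=
  is_ideal I /\ mor_class_eq I (ideal_gen (Ob I)).

Definition lperp (J : mor_class) : mor_class := fun X0 X1 f =>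
  forall (Y0 Y1 : A) (g : hom A Y0 Y1), J Y0 Y1 g -> Ext1_map_zero f g.

Definition rperp (I : mor_class) : mor_class := fun Y0 Y1 g =>
  forall (X0 X1 : A) (f : hom A X0 X1), I X0 X1 f -> Ext1_map_zero f g.

Record ideal_cotorsion_pair (I J : mor_class) : Prop := IdealCotorsionPair {
  icp_ideall : is_ideal I;
  icp_idealr : is_ideal J;
  icp_lperp : mor_class_eq I (lperp J);
  icp_rperp : mor_class_eq J (rperp I)
}.

Definition ideal_precover (I : mor_class) (E X : A) (p : hom A E X) : Prop :=
  I E X p /\
  forall (W : A) (f : hom A W X), I W X f -> exists u : hom A W E, p \oc u = f.

Definition ideal_preenvelope (J : mor_class) (X D : A) (j : hom A X D) : Prop :=
  J X D j /\
  forall (W : A) (f : hom A X W), J X W f -> exists u : hom A D W, u \oc j = f.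

Definition special_ideal_precover (I : mor_class) (E X : A)
    (p : hom A E X) : Prop :=
  ideal_precover I p /\
  exists (Y B : A) (xi : extension X Y) (g : hom A Y B)
    (b : hom A B E) (c : conf b p),
    rperp I g /\ ext_pushout g xi (Extension c).

Definition special_ideal_preenvelope (J : mor_class) (X D : A)
    (j : hom A X D) : Prop :=
  ideal_preenvelope J j /\
  exists (Y B : A) (xi : extension Y X) (f : hom A B Y)
    (b : hom A D B) (c : conf j b),
    lperp J f /\ ext_pullback f xi (Extension c).

Definition complete_ideal_cotorsion_pair (I J : mor_class) : Prop :=
  [/\ ideal_cotorsion_pair I J,
      forall X : A, exists (E : A) (p : hom A E X), special_ideal_precover I p
    & forall X : A, exists (D : A) (j : hom A X D),
        special_ideal_preenvelope J j].

Definition cotorsion_pair (F C : obj_class) : Prop :=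
  obj_class_eq F (fun X => forall Y : A, C Y -> Ext1_zero X Y) /\
  obj_class_eq C (fun Y => forall X : A, F X -> Ext1_zero X Y).

Definition has_special_precover (F C : obj_class) (X : A) : Prop :=
  exists (K E : A) (i : hom A K E) (p : hom A E X), [/\ conf i p, F E & C K].

Definition has_special_preenvelope (F C : obj_class) (X : A) : Prop :=
  exists (E K : A) (i : hom A X E) (p : hom A E K), [/\ conf i p, C E & F K].

Definition special_precovering (F C : obj_class) : Prop :=
  forall X : A, has_special_precover F C X.

Definition special_preenveloping (F C : obj_class) : Prop :=
  forall X : A, has_special_preenvelope F C X.

End Exact.

(** A differential is given for every pair of degrees and required to vanish
    unless the second is the successor of the first; this avoids transporting
    along [n - 1 + 1 = n]. *)
Record cochain (k : fieldType) := Cochain {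
  cterm :> int -> vectType k;
  cdiff : forall i j : int, 'Hom(cterm i, cterm j);
  cdiff_shape : forall i j : int, j != i + 1 -> cdiff i j = 0;
  cdiff_sq : forall i j l : int, (cdiff j l \o cdiff i j)%VF = 0;
  cbounded : exists a b : int, forall n : int, (n < a) || (b < n) ->
    \dim {: cterm n} = 0%N
}.

Section ChainMaps.
Variable k : fieldType.
Implicit Types X Y Z : cochain k.

Record chmap X Y := ChMap {
  chmap_fun :> forall n : int, 'Hom(X n, Y n);
  chmap_comm : forall i j : int,
    (chmap_fun j \o cdiff X i j)%VF = (cdiff Y i j \o chmap_fun i)%VF
}.

Lemma chmapP X Y (f g : chmap X Y) : (forall n, f n = g n) -> f = g.
Proof.
case: f g => [f cf] [g cg] /= efg.
have {}efg : f = g by exact: functional_extensionality_dep.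
by subst g; congr ChMap; exact: Prop_irrelevance.
Qed.

HB.instance Definition _ X Y := gen_eqMixin (chmap X Y).
HB.instance Definition _ X Y := gen_choiceMixin (chmap X Y).

Section Linear.
Variables X Y : cochain k.
Implicit Types f g h : chmap X Y.

Fact chmap0_subproof (i j : int) :
  ((0 : 'Hom(X j, Y j)) \o cdiff X i j)%VF = (cdiff Y i j \o 0)%VF.
Proof. by rewrite comp_lfun0l comp_lfun0r. Qed.
Definition chmap0 : chmap X Y := ChMap chmap0_subproof.

Fact chmap_opp_subproof f (i j : int) :
  ((- f j) \o cdiff X i j)%VF = (cdiff Y i j \o (- f i))%VF.
Proof. by rewrite comp_lfunNl comp_lfunNr chmap_comm. Qed.
Definition chmap_opp f : chmap X Y := ChMap (chmap_opp_subproof f).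

Fact chmap_add_subproof f g (i j : int) :
  ((f j + g j) \o cdiff X i j)%VF = (cdiff Y i j \o (f i + g i))%VF.
Proof. by rewrite comp_lfunDl comp_lfunDr !chmap_comm. Qed.
Definition chmap_add f g : chmap X Y := ChMap (chmap_add_subproof f g).

Fact chmap_scale_subproof (a : k) f (i j : int) :
  ((a *: f j) \o cdiff X i j)%VF = (cdiff Y i j \o (a *: f i))%VF.
Proof. by rewrite -comp_lfunZl -comp_lfunZr chmap_comm. Qed.
Definition chmap_scale (a : k) f : chmap X Y := ChMap (chmap_scale_subproof a f).

Fact chmap_addA : associative chmap_add.
Proof. by move=> f g h; apply: chmapP => n /=; rewrite addrA. Qed.
Fact chmap_addC : commutative chmap_add.
Proof. by move=> f g; apply: chmapP => n /=; rewrite addrC. Qed.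
Fact chmap_add0 : left_id chmap0 chmap_add.
Proof. by move=> f; apply: chmapP => n /=; rewrite add0r. Qed.
Fact chmap_addN : left_inverse chmap0 chmap_opp chmap_add.
Proof. by move=> f; apply: chmapP => n /=; rewrite addNr. Qed.

HB.instance Definition _ := GRing.isZmodule.Build (chmap X Y)
  chmap_addA chmap_addC chmap_add0 chmap_addN.

Fact chmap_scaleA (a b : k) f :
  chmap_scale a (chmap_scale b f) = chmap_scale (a * b) f.
Proof. by apply: chmapP => n /=; rewrite scalerA. Qed.
Fact chmap_scale1 : left_id 1 chmap_scale.
Proof. by move=> f; apply: chmapP => n /=; rewrite scale1r. Qed.
Fact chmap_scaleDr : right_distributive chmap_scale +%R.
Proof. by move=> a f g; apply: chmapP => n /=; rewrite scalerDr. Qed.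
Fact chmap_scaleDl f : {morph chmap_scale^~ f : a b / a + b}.
Proof. by move=> a b; apply: chmapP => n /=; rewrite scalerDl. Qed.

HB.instance Definition _ := GRing.Zmodule_isLmodule.Build k (chmap X Y)
  chmap_scaleA chmap_scale1 chmap_scaleDr chmap_scaleDl.

End Linear.

Fact chmap_id_subproof X (i j : int) :
  (\1 \o cdiff X i j)%VF = (cdiff X i j \o \1)%VF.
Proof. by rewrite comp_lfun1l comp_lfun1r. Qed.
Definition chmap_id X : chmap X X := ChMap (@chmap_id_subproof X).

Fact chmap_comp_subproof X Y Z (g : chmap Y Z) (f : chmap X Y) (i j : int) :
  ((g j \o f j) \o cdiff X i j)%VF = (cdiff Z i j \o (g i \o f i))%VF.
Proof. by rewrite -comp_lfunA chmap_comm comp_lfunA chmap_comm comp_lfunA. Qed.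
Definition chmap_comp X Y Z (g : chmap Y Z) (f : chmap X Y) : chmap X Z :=
  ChMap (chmap_comp_subproof g f).

Fact chmap_comp1l X Y (f : chmap X Y) : chmap_comp (chmap_id Y) f = f.
Proof. by apply: chmapP => n /=; rewrite comp_lfun1l. Qed.
Fact chmap_comp1r X Y (f : chmap X Y) : chmap_comp f (chmap_id X) = f.
Proof. by apply: chmapP => n /=; rewrite comp_lfun1r. Qed.
Fact chmap_compA W X Y Z (h : chmap Y Z) (g : chmap X Y) (f : chmap W X) :
  chmap_comp h (chmap_comp g f) = chmap_comp (chmap_comp h g) f.
Proof. by apply: chmapP => n /=; rewrite comp_lfunA. Qed.
Fact chmap_comp_linl X Y Z (a : k) (g g' : chmap Y Z) (f : chmap X Y) :
  chmap_comp (a *: g + g') f = a *: chmap_comp g f + chmap_comp g' f.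
Proof. by apply: chmapP => n /=; rewrite comp_lfunDl comp_lfunZl. Qed.
Fact chmap_comp_linr X Y Z (a : k) (g : chmap Y Z) (f f' : chmap X Y) :
  chmap_comp g (a *: f + f') = a *: chmap_comp g f + chmap_comp g f'.
Proof. by apply: chmapP => n /=; rewrite comp_lfunDr comp_lfunZr. Qed.

End ChainMaps.

Definition Chb (k : fieldType) : lincat k :=
  @LinCat k (cochain k) (fun X Y => chmap X Y : lmodType k) (@chmap_id k)
    (@chmap_comp k) (@chmap_comp1l k) (@chmap_comp1r k) (@chmap_compA k)
    (@chmap_comp_linl k) (@chmap_comp_linr k).

Section Complexes.
Variable k : fieldType.

Definition short_exact (X Y Z : cochain k) (i : chmap X Y) (p : chmap Y Z) :
    Prop :=
  forall n : int,
    [/\ lker (i n) = 0%VS, limg (i n) = lker (p n) & limg (p n) = fullv].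

(** H^n(X) = ker d^n / im d^(n-1); quotient spaces are realized by the
    library's relative complements [U :\: V], of dimension
    [\dim U - \dim V] when V is a subspace of U. *)
Definition cohomology (X : cochain k) (n : int) : {vspace X n} :=
  (lker (cdiff X n (n + 1)) :\: limg (cdiff X (n - 1) n))%VS.

Definition betti (X : cochain k) : nat :=
  \sum_(n \in [set: int]%classic) \dim (cohomology X n).

Lemma cohomology_dim (X : cochain k) (n : int) :
  \dim (cohomology X n) =
  (\dim (lker (cdiff X n (n + 1))) - \dim (limg (cdiff X (n - 1) n)))%N.
Proof.
rewrite -(dimv_cap_compl (lker _) (limg (cdiff X (n - 1) n))).
suff /capv_idPr -> : (limg (cdiff X (n - 1) n) <=
    lker (cdiff X n (n + 1)))%VS by rewrite addKn.
apply/subvP => _ /memv_imgP[u _ ->].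
by rewrite memv_ker -comp_lfunE cdiff_sq lfunE.
Qed.

Definition stalk_term (r : int) (V : vectType k) (n : int) : vectType k :=
  if n == r then V else 'rV[k]_0.

Fact stalk_bounded (r : int) (V : vectType k) :
  exists a b : int, forall n : int, (n < a) || (b < n) ->
    \dim {: stalk_term r V n} = 0%N.
Proof.
exists r, r => n; rewrite -Order.TotalTheory.neq_lt /stalk_term dimvf.
by move=> /negPf ->; rewrite /dim /= ?mul1n.
Qed.

Definition stalk (r : int) (V : vectType k) : cochain k :=
  @Cochain k (stalk_term r V) (fun i j => 0) (fun i j _ => erefl)
    (fun i j l => comp_lfun0l _ _) (stalk_bounded r V).

Section DirectSum.
Variables X Y : cochain k.

Definition dsum_term (n : int) : vectType k := (X n * Y n)%type.

Definition dsum_diff_fun (i j : int) (u : dsum_term i) : dsum_term j :=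
  (cdiff X i j u.1, cdiff Y i j u.2).

Fact dsum_diff_linear (i j : int) : linear (@dsum_diff_fun i j).
Proof. by move=> a u v; rewrite /dsum_diff_fun /= !linearP. Qed.

HB.instance Definition _ (i j : int) :=
  GRing.isLinear.Build k (dsum_term i) (dsum_term j) _
    (@dsum_diff_fun i j) (@dsum_diff_linear i j).

Definition dsum_diff (i j : int) : 'Hom(dsum_term i, dsum_term j) :=
  linfun (@dsum_diff_fun i j).

Lemma dsum_diffE (i j : int) (u : dsum_term i) :
  dsum_diff i j u = (cdiff X i j u.1, cdiff Y i j u.2).
Proof. by rewrite lfunE. Qed.

Fact dsum_diff_shape (i j : int) : j != i + 1 -> dsum_diff i j = 0.
Proof.
move=> ij; apply/lfunP => u.
by rewrite dsum_diffE !cdiff_shape // !lfunE.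
Qed.

Fact dsum_diff_sq (i j l : int) : (dsum_diff j l \o dsum_diff i j)%VF = 0.
Proof.
apply/lfunP => u; rewrite comp_lfunE !dsum_diffE /=.
by rewrite -!comp_lfunE !cdiff_sq !lfunE.
Qed.

Fact dsum_bounded : exists a b : int, forall n : int, (n < a) || (b < n) ->
  \dim {: dsum_term n} = 0%N.
Proof.
have [a [b hX]] := cbounded X; have [a' [b' hY]] := cbounded Y.
exists (Num.min a a'), (Num.max b b') => n.
rewrite Order.TotalTheory.lt_min Order.TotalTheory.gt_max => hn.
have -> : \dim {: dsum_term n} = (\dim {: X n} + \dim {: Y n})%N.
  by rewrite !dimvf.
rewrite hX ?hY //.
  by case/orP: hn => /andP[h1 h2]; rewrite ?h2 ?orbT.
by case/orP: hn => /andP[h1 h2]; rewrite ?h1 ?orbT.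
Qed.

Definition dsum : cochain k :=
  @Cochain k dsum_term dsum_diff dsum_diff_shape dsum_diff_sq dsum_bounded.

End DirectSum.

Definition even_betti (X : Chb k) : Prop := ~~ odd (betti X).

Definition evenCh : lincat k := full_subcat even_betti.

Definition evenCh_conf : conf_class evenCh :=
  fun X Y Z i p => @short_exact (sval X) (sval Y) (sval Z) i p.

Definition classF : obj_class evenCh :=
  fun X => forall n : int, 1 <= n -> cohomology (sval X) n = 0%VS.

Definition classC : obj_class evenCh :=
  fun X => forall n : int, n <= 1 -> cohomology (sval X) n = 0%VS.

Definition objM : Chb k := dsum (stalk 0 k^o) (stalk 2 k^o).

End Complexes.

(* Main.v *)
From HB Require Import structures.
From mathcomp Require Import all_boot all_order all_algebra.
From mathcomp Require Import boolp classical_sets fsbigop.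
From mathcomp Require Import zify.
Require Import Defs.

Set Implicit Arguments.
Unset Strict Implicit.
Unset Printing Implicit Defensive.

Import Order.TTheory GRing.Theory Num.Theory.
Local Open Scope ring_scope.

(** Over a field all the homological information is in cohomology.  An
    extension of bounded complexes is split in each degree, and its class is
    measured by a degree-one map [phi] that anticommutes with the differentials;
    pulling back along [f] and pushing out along [g] turns [phi] into
    [g phi f] ([ext_cocycle_map]), and the extension splits as soon as this map
    is null-homotopic.  A map sending cocycles to coboundaries is null-homotopic
    ([one_cocycle_null]), so [Ext^1(X, Y) = 0] as soon as, for each [n], one of
    [H^n(X)] and [H^(n+1)(Y)] vanishes ([orth_null]).  This gives the
    orthogonality of [F] and [C] and, applied to acyclic complexes, identifies
    the projectives and the injectives with the acyclic complexes.

    By rank-nullity the total Betti number has the parity of the total dimension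
    ([odd_betti]), so parity is additive on short exact sequences.  Hence kernels
    and cokernels of maps between even complexes are even, the deflations of [A]
    are the degreewise surjective maps and the inflations the degreewise
    injective ones, and the exact structure is inherited from all complexes.

    In the category of all bounded complexes, every [X] has approximations
    [K -> L -> X] and [X -> D -> G] with [L, G] without cohomology in positive
    degrees and [K, D] without cohomology in degrees at most one
    ([precover_exists], [preenvelope_exists]).  For even [X] the terms [K, L] can
    be odd, and then adding [S^2(k)] to both makes the approximation even.  This
    destroys [L] being in [F], but not the fact that [L -> X] factors through an
    object of [F], since [S^2(k)] maps to zero and can be traded for [S^0(k)]
    ([even_precover]).  That is all that ideals of morphisms can see: the pair of
    ideals is complete, and the usual argument with approximations computes both
    orthogonals.  Objects do see the parity: an approximation of
    [M = S^0(k) + S^2(k)] by objects of the pair would have a middle term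
    quasi-isomorphic to [S^0(k)] or [S^2(k)], whose Betti number is odd. *)

(** * Bounded complexes: kernels, cokernels and direct sums *)

(** [linearD] and [linearB] stated on homomorphisms, so that no
    simplification that would unfold a differential has to follow. *)
Lemma homD (k : fieldType) (U V : vectType k) (f : 'Hom(U, V)) u v :
  f (u + v) = f u + f v.
Proof. exact: linearD. Qed.

Lemma homB (k : fieldType) (U V : vectType k) (f : 'Hom(U, V)) u v :
  f (u - v) = f u - f v.
Proof. exact: linearB. Qed.

Section Elements.
Variable k : fieldType.
Implicit Types X Y Z W K : cochain k.

Lemma chmapE X Y (f : chmap X Y) (i j : int) (x : X i) :
  f j (cdiff X i j x) = cdiff Y i j (f i x).
Proof. by rewrite -!comp_lfunE chmap_comm. Qed.

Lemma diffK X (i j l : int) (x : X i) : cdiff X j l (cdiff X i j x) = 0.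
Proof. by rewrite -comp_lfunE cdiff_sq lfunE. Qed.

Lemma chmap_ext X Y (f g : chmap X Y) : (forall n x, f n x = g n x) -> f = g.
Proof. by move=> fg; apply: chmapP => n; apply/lfunP => x; apply: fg. Qed.

Lemma chmap0E X Y n x : (0 : chmap X Y) n x = 0.
Proof. exact: lfunE. Qed.

Lemma chmapDE X Y (f g : chmap X Y) n x : (f + g) n x = f n x + g n x.
Proof. exact: add_lfunE. Qed.

Lemma chmapNE X Y (f : chmap X Y) n x : (- f) n x = - f n x.
Proof. exact: opp_lfunE. Qed.

Lemma chmap_compE X Y Z (g : chmap Y Z) (f : chmap X Y) n x :
  chmap_comp g f n x = g n (f n x).
Proof. exact: comp_lfunE. Qed.

Lemma chmap_idE X n x : chmap_id X n x = x.
Proof. exact: id_lfunE. Qed.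

Definition chE :=
  (chmap_compE, chmap0E, chmapDE, chmapNE, chmap_idE, chmapE).

Lemma chmap_eq X Y (f g : chmap X Y) n x : f = g -> f n x = g n x.
Proof. by move->. Qed.

Lemma chmap_intro X Y (F : forall n, 'Hom(X n, Y n)) :
  (forall i j x, F j (cdiff X i j x) = cdiff Y i j (F i x)) ->
  exists f : chmap X Y, forall n x, f n x = F n x.
Proof.
move=> FP; suff FC i j : (F j \o cdiff X i j)%VF = (cdiff Y i j \o F i)%VF.
  by exists (ChMap FC).
by apply/lfunP => x; rewrite !comp_lfunE.
Qed.

Definition inj X Y (f : chmap X Y) := forall n x, f n x = 0 -> x = 0.
Definition surj X Y (f : chmap X Y) := forall n y, exists x, f n x = y.

Lemma injP X Y (f : chmap X Y) : inj f -> forall n, injective (f n).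
Proof.
by move=> fi n x y fxy; apply/eqP; rewrite -subr_eq0; apply/eqP/(fi n);
   rewrite linearB /= fxy subrr.
Qed.

Variant ses_spec X Y Z (i : chmap X Y) (p : chmap Y Z) : Prop :=
  SesSpec of inj i & surj p & (forall n x, p n (i n x) = 0) &
    (forall n y, p n y = 0 -> exists x, i n x = y).

Lemma short_exactP X Y Z (i : chmap X Y) (p : chmap Y Z) :
  short_exact i p <-> ses_spec i p.
Proof.
split=> [se | [ii sp pi ex] n].
  split=> [n x ix0 | n z | n x | n y py0]; have [ki ip rp] := se n.
  - by apply/eqP; rewrite -memv0 -ki memv_ker ix0.
  - have: z \in limg (p n) by rewrite rp memvf.
    by case/memv_imgP => y _ ->; exists y.
  - by apply/eqP; rewrite -memv_ker -ip memv_img ?memvf.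
  - have: y \in limg (i n) by rewrite ip memv_ker py0.
    by case/memv_imgP => x _ ->; exists x.
split.
- by apply/eqP/lker0P/injP.
- apply/vspaceP => y; apply/memv_imgP/idP => [[x _ ->]|].
    by rewrite memv_ker pi.
  by rewrite memv_ker => /eqP/ex[x <-]; exists x; rewrite ?memvf.
- apply/vspaceP => z; rewrite memvf; apply/memv_imgP.
  by have [y <-] := sp n z; exists y; rewrite ?memvf.
Qed.

Lemma injK X Y (f : chmap X Y) : inj f -> forall n, cancel (f n) ((f n)^-1)%VF.
Proof. by move=> fi n; apply/lker0_lfunK/lker0P/injP. Qed.

Lemma surjK X Y (f : chmap X Y) : surj f -> forall n, cancel ((f n)^-1)%VF (f n).
Proof.
by move=> fs n y; have [x <-] := fs n y; apply: limg_lfunVK; rewrite memv_img ?memvf.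
Qed.

(** The factorization is forced degreewise, so it only has to be checked to
    commute with the differentials. *)
Lemma kernel_factor X Y Z W (i : chmap X Y) (p : chmap Y Z) (h : chmap W Y) :
  short_exact i p -> chmap_comp p h = 0 ->
  exists u : chmap W X, chmap_comp i u = h.
Proof.
move=> /short_exactP[ii _ _ ex] ph.
have iV n w : i n ((i n)^-1%VF (h n w)) = h n w.
  have [|x <-] := ex n (h n w); last by rewrite injK.
  by rewrite -chmap_compE ph chmap0E.
have [a b w|u uE] := @chmap_intro W X (fun n => ((i n)^-1 \o h n)%VF).
  by apply: (injP ii); rewrite !comp_lfunE !chmapE iV -chmapE iV chmapE.
by exists u; apply: chmap_ext => n w; rewrite chE uE comp_lfunE iV.
Qed.

Lemma cokernel_factor X Y Z W (i : chmap X Y) (p : chmap Y Z) (h : chmap Y W) :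
  short_exact i p -> chmap_comp h i = 0 ->
  exists u : chmap Z W, chmap_comp u p = h.
Proof.
move=> /short_exactP[_ sp _ ex] hi.
have hV n y : h n ((p n)^-1%VF (p n y)) = h n y.
  apply/eqP; rewrite -subr_eq0 -linearB /=.
  have [|x <-] := ex n ((p n)^-1%VF (p n y) - y); last first.
    by rewrite -chmap_compE hi chmap0E.
  by rewrite linearB /= surjK // subrr.
have [a b z|u uE] := @chmap_intro Z W (fun n => (h n \o (p n)^-1)%VF).
  have [y <-] := sp a z.
  by rewrite !comp_lfunE -chmapE !hV chmapE.
by exists u; apply: chmap_ext => n y; rewrite chE uE comp_lfunE hV.
Qed.

Lemma inj_cancel X Y W (i : chmap X Y) (u v : chmap W X) : inj i ->
  chmap_comp i u = chmap_comp i v -> u = v.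
Proof.
move=> ii iuv; apply: chmap_ext => n x; apply: (injP ii).
by have := chmap_eq x iuv; rewrite !chE.
Qed.

Lemma surj_cancel X Y W (p : chmap X Y) (u v : chmap Y W) : surj p ->
  chmap_comp u p = chmap_comp v p -> u = v.
Proof.
move=> sp upv; apply: chmap_ext => n y; have [x <-] := sp n y.
by have := chmap_eq x upv; rewrite !chE.
Qed.

(** Data for a complex whose terms are retracts of those of [X], with the
    differential transported along the retractions: it covers subcomplexes
    and quotient complexes at once. *)
Section Retract.
Variables (X : cochain k) (V : int -> vectType k).
Variables (s : forall n, 'Hom(V n, X n)) (r : forall n, 'Hom(X n, V n)).
Hypothesis sK : forall n x, r n (s n x) = x.
Hypothesis rds : forall i j l x,
  r l (cdiff X j l (s j (r j (cdiff X i j (s i x))))) = 0.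

Definition retract_diff i j : 'Hom(V i, V j) := (r j \o (cdiff X i j \o s i))%VF.

Fact retract_shape i j : j != i + 1 -> retract_diff i j = 0.
Proof. by move=> ij; rewrite /retract_diff cdiff_shape // comp_lfun0l comp_lfun0r. Qed.

Fact retract_sq i j l : (retract_diff j l \o retract_diff i j)%VF = 0.
Proof. by apply/lfunP => x; rewrite !comp_lfunE rds lfunE. Qed.

Fact retract_bounded : exists a b : int, forall n : int, (n < a) || (b < n) ->
  \dim {: V n} = 0%N.
Proof.
have [a [b XP]] := cbounded X; exists a, b => n /XP X0.
have /eqP s0 : lker (s n) == 0%VS.
  by apply/lker0P => x y sxy; rewrite -(sK x) sxy sK.
by apply/eqP; rewrite -leqn0 -X0 -(limg_dim_eq (f := s n)) ?dimvS ?subvf ?s0 ?capv0.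
Qed.

Definition retract := Cochain retract_shape retract_sq retract_bounded.

Lemma retractE i j x : cdiff retract i j x = r j (cdiff X i j (s i x)).
Proof. by rewrite /= !comp_lfunE. Qed.
End Retract.


Lemma kernel_complex Y Z (p : chmap Y Z) :
  exists K (i : chmap K Y), [/\ inj i, forall n x, p n (i n x) = 0 &
    forall n y, p n y = 0 -> exists x, i n x = y].
Proof.
pose V n : vectType k := subvs_of (lker (p n)).
pose s n : 'Hom(V n, Y n) := linfun (@vsval k (Y n) (lker (p n))).
pose r n : 'Hom(Y n, V n) := linfun (@vsproj k (Y n) (lker (p n))).
have sE n x : s n x = vsval x by rewrite lfunE.
have sr n y : p n y = 0 -> s n (r n y) = y.
  by move=> py; rewrite /s /r !lfunE /= vsprojK // memv_ker py.
have sK n x : r n (s n x) = x by rewrite /s /r !lfunE /= vsvalK.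
have ps n x : p n (s n x) = 0.
  by rewrite sE; apply/eqP; rewrite -memv_ker subvsP.
have rds i j l x : r l (cdiff Y j l (s j (r j (cdiff Y i j (s i x))))) = 0.
  by rewrite sr ?diffK ?linear0 // chmapE ps linear0.
exists (retract sK rds).
have [i j x|f fE] := @chmap_intro (retract sK rds) Y s.
  by rewrite retractE sr // chmapE ps linear0.
exists f; split=> [n x|n x|n y py].
- by rewrite fE => s0; rewrite -(sK n x) s0 linear0.
- by rewrite fE ps.
- by exists (r n y); rewrite fE sr.
Qed.

Lemma cokernel_complex X Y (i : chmap X Y) :
  exists Q (q : chmap Y Q), [/\ surj q, forall n x, q n (i n x) = 0 &
    forall n y, q n y = 0 -> exists x, i n x = y].
Proof.
pose U n := limg (i n).
pose V n : vectType k := subvs_of (U n)^C%VS.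
pose s n : 'Hom(V n, Y n) := linfun (@vsval k (Y n) (U n)^C%VS).
pose r n : 'Hom(Y n, V n) :=
  (linfun (@vsproj k (Y n) (U n)^C%VS) \o daddv_pi (U n)^C (U n))%VF.
have sE n x : s n x = vsval x by rewrite lfunE.
have UC n : ((U n)^C :&: U n = 0)%VS by rewrite capvC capv_compl.
have sr n y : s n (r n y) = daddv_pi (U n)^C (U n) y.
  by rewrite /r comp_lfunE /s !lfunE /= vsprojK // memv_pi.
have sK n x : r n (s n x) = x.
  by rewrite /r comp_lfunE sE daddv_pi_id ?subvsP // lfunE /= vsvalK.
have ri n x : r n (i n x) = 0.
  rewrite /r comp_lfunE; suff -> : daddv_pi (U n)^C (U n) (i n x) = 0 by rewrite linear0.
  have := daddv_pi_add (UC n) (w := i n x); rewrite addvC addv_complf memvf => /(_ isT).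
  rewrite [X in _ + X]daddv_pi_id ?capv_compl ?memv_img ?memvf //.
  by move/(canRL (addrK _)); rewrite subrr.
have rE n y : exists x, y - s n (r n y) = i n x.
  have := daddv_pi_add (UC n) (w := y); rewrite addvC addv_complf memvf => /(_ isT) yE.
  have /memv_imgP[x _ xE] := memv_pi (U n) (U n)^C y.
  by exists x; rewrite sr -[X in X - _]yE addrC addKr xE.
have rd a b y : r b (cdiff Y a b (s a (r a y))) = r b (cdiff Y a b y).
  have [x xE] := rE a y; apply/eqP; rewrite eq_sym -subr_eq0 -!linearB /= xE.
  by rewrite -chmapE ri.
have rds a b c x : r c (cdiff Y b c (s b (r b (cdiff Y a b (s a x))))) = 0.
  by rewrite rd diffK linear0.
exists (retract sK rds).
have [a b x|f fE] := @chmap_intro Y (retract sK rds) r.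
  by rewrite retractE rd.
exists f; split=> [n x|n x|n y].
- by exists (s n x); rewrite fE sK.
- by rewrite fE ri.
- by rewrite fE => ry; have [x] := rE n y; rewrite ry linear0 subr0; exists x.
Qed.

Section DirectSum.
Variables X Y : cochain k.

Definition inl_fun n (x : X n) : dsum X Y n := (x, 0).
Definition inr_fun n (y : Y n) : dsum X Y n := (0, y).
Definition prl_fun n (u : dsum X Y n) : X n := u.1.
Definition prr_fun n (u : dsum X Y n) : Y n := u.2.

Fact inl_linear n : linear (@inl_fun n).
Proof.
move=> a x y; congr pair; exact: (esym (etrans (addr0 _) (scaler0 _ _))).
Qed.
Fact inr_linear n : linear (@inr_fun n).
Proof.
move=> a x y; congr pair; exact: (esym (etrans (addr0 _) (scaler0 _ _))).
Qed.
Fact prl_linear n : linear (@prl_fun n). Proof. by []. Qed.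
Fact prr_linear n : linear (@prr_fun n). Proof. by []. Qed.

HB.instance Definition _ n :=
  GRing.isLinear.Build k (X n) (dsum X Y n) _ (@inl_fun n) (@inl_linear n).
HB.instance Definition _ n :=
  GRing.isLinear.Build k (Y n) (dsum X Y n) _ (@inr_fun n) (@inr_linear n).
HB.instance Definition _ n :=
  GRing.isLinear.Build k (dsum X Y n) (X n) _ (@prl_fun n) (@prl_linear n).
HB.instance Definition _ n :=
  GRing.isLinear.Build k (dsum X Y n) (Y n) _ (@prr_fun n) (@prr_linear n).

Fact inl_comm i j :
  (linfun (@inl_fun j) \o cdiff X i j)%VF =
  (cdiff (dsum X Y) i j \o linfun (@inl_fun i))%VF.
Proof.
apply/lfunP => x; rewrite !comp_lfunE !(lfunE (@inl_fun _)) dsum_diffE /=.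
by rewrite /inl_fun /= linear0.
Qed.
Fact inr_comm i j :
  (linfun (@inr_fun j) \o cdiff Y i j)%VF =
  (cdiff (dsum X Y) i j \o linfun (@inr_fun i))%VF.
Proof.
apply/lfunP => x; rewrite !comp_lfunE !(lfunE (@inr_fun _)) dsum_diffE /=.
by rewrite /inr_fun /= linear0.
Qed.
Fact prl_comm i j :
  (linfun (@prl_fun j) \o cdiff (dsum X Y) i j)%VF =
  (cdiff X i j \o linfun (@prl_fun i))%VF.
Proof. by apply/lfunP => x; rewrite !comp_lfunE !(lfunE (@prl_fun _)) dsum_diffE. Qed.
Fact prr_comm i j :
  (linfun (@prr_fun j) \o cdiff (dsum X Y) i j)%VF =
  (cdiff Y i j \o linfun (@prr_fun i))%VF.
Proof. by apply/lfunP => x; rewrite !comp_lfunE !(lfunE (@prr_fun _)) dsum_diffE. Qed.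

Definition dinl : chmap X (dsum X Y) := ChMap inl_comm.
Definition dinr : chmap Y (dsum X Y) := ChMap inr_comm.
Definition prl : chmap (dsum X Y) X := ChMap prl_comm.
Definition prr : chmap (dsum X Y) Y := ChMap prr_comm.

Lemma inlE n x : dinl n x = (x, 0). Proof. exact: (lfunE (@inl_fun n)). Qed.
Lemma inrE n y : dinr n y = (0, y). Proof. exact: (lfunE (@inr_fun n)). Qed.
Lemma prlE n u : prl n u = u.1. Proof. exact: (lfunE (@prl_fun n)). Qed.
Lemma prrE n u : prr n u = u.2. Proof. exact: (lfunE (@prr_fun n)). Qed.
Definition dsE := (inlE, inrE, prlE, prrE).

Lemma dsum_decomp n (u : dsum X Y n) : u = dinl n (prl n u) + dinr n (prr n u).
Proof.
by rewrite !dsE [RHS]/GRing.add /= /add_pair /= addr0 add0r; case: u.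
Qed.

Lemma prl_inl n x : prl n (dinl n x) = x. Proof. by rewrite !dsE. Qed.
Lemma prr_inr n y : prr n (dinr n y) = y. Proof. by rewrite !dsE. Qed.
Lemma prl_inr n y : prl n (dinr n y) = 0. Proof. by rewrite !dsE. Qed.
Lemma prr_inl n x : prr n (dinl n x) = 0. Proof. by rewrite !dsE. Qed.

Lemma prl_pair n x y : prl n (dinl n x + dinr n y) = x.
Proof. by rewrite homD prl_inl prl_inr addr0. Qed.
Lemma prr_pair n x y : prr n (dinl n x + dinr n y) = y.
Proof. by rewrite homD prr_inl prr_inr add0r. Qed.

Lemma dsum_eq0 n (u : dsum X Y n) : prl n u = 0 -> prr n u = 0 -> u = 0.
Proof. by move=> u1 u2; rewrite [u]dsum_decomp u1 u2 !linear0 addr0. Qed.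

End DirectSum.

Definition dsK := (prl_pair, prr_pair, prl_inl, prr_inr, prl_inr, prr_inl).

Arguments dinl {X Y}.
Arguments dinr {X Y}.
Arguments prl {X Y}.
Arguments prr {X Y}.

(** A summand [T] added to both the first and the middle term, or to both the
    middle and the last term, changes their parities without changing the
    remaining term. *)
Lemma short_exact_addl K L X T (i : chmap K L) (p : chmap L X) :
  short_exact i p ->
  short_exact (chmap_comp dinl (chmap_comp i prl) + chmap_comp dinr prr :
    chmap (dsum K T) (dsum L T)) (chmap_comp p prl).
Proof.
move=> /short_exactP[ii sp pi ex]; apply/short_exactP; split=> [n u|n x|n u|n u].
- rewrite !chE => u0; apply: dsum_eq0.
    by apply: (ii n); have := congr1 (prl n) u0; rewrite linearD /= !dsK linear0 addr0.
  by have := congr1 (prr n) u0; rewrite linearD /= !dsK linear0 add0r.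
- by have [y <-] := sp n x; exists (dinl n y); rewrite !chE dsK.
- by rewrite !chE linearD /= !dsK addr0 pi.
- rewrite !chE => /ex[x ix]; exists (dinl n x + dinr n (prr n u)).
  by rewrite !chE !linearD /= !dsK !linear0 !(addr0, add0r) ix -dsum_decomp.
Qed.

Lemma short_exact_addr X D G T (j : chmap X D) (q : chmap D G) :
  short_exact j q ->
  short_exact (chmap_comp dinl j : chmap X (dsum D T))
    (chmap_comp dinl (chmap_comp q prl) + chmap_comp dinr prr :
       chmap (dsum D T) (dsum G T)).
Proof.
move=> /short_exactP[ij sq qj ex]; apply/short_exactP; split=> [n x|n u|n x|n u].
- by rewrite chE => /(congr1 (prl n)); rewrite dsK linear0 => /ij.
- have [y yE] := sq n (prl n u); exists (dinl n y + dinr n (prr n u)).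
  by rewrite !chE !linearD /= !dsK !linear0 !(addr0, add0r) yE -dsum_decomp.
- by rewrite !chE !dsK qj !linear0 addr0.
- rewrite !chE => u0; have [|x xE] := ex n (prl n u).
    by have := congr1 (prl n) u0; rewrite linearD /= !dsK linear0 addr0.
  exists x; rewrite chE xE [u in RHS]dsum_decomp.
  have := congr1 (prr n) u0; rewrite linearD /= !dsK linear0 add0r => ->.
  by rewrite linear0 addr0.
Qed.

Lemma dsum_short_exact X Y : short_exact (dinl : chmap X (dsum X Y)) prr.
Proof.
apply/short_exactP; split=> [n x|n y|n x|n u u0].
- by move/(congr1 (prl n)); rewrite dsK linear0.
- by exists (dinr n y); rewrite dsK.
- by rewrite dsK.
- by exists (prl n u); rewrite [u in RHS]dsum_decomp u0 linear0 addr0.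
Qed.

End Elements.
Arguments dinl {k X Y}.
Arguments dinr {k X Y}.
Arguments prl {k X Y}.
Arguments prr {k X Y}.

(** * Cohomology, cocycle by cocycle *)

Section Cohomology.
Variable k : fieldType.
Implicit Types X Y Z W K : cochain k.

Definition cocycle X n (z : X n) := cdiff X n (n + 1) z = 0.
Definition coboundary X n (z : X n) := exists y, cdiff X (n - 1) n y = z.
Definition acyclic_at X n := forall z : X n, cocycle z -> coboundary z.
Definition acyclic X := forall n, acyclic_at X n.

Lemma cocycleP X n (z : X n) : cocycle z -> forall j, cdiff X n j z = 0.
Proof.
move=> dz j; have [->//|nj] := eqVneq j (n + 1).
by rewrite cdiff_shape // lfunE.
Qed.

Lemma cocycle_succ X m n (z : X m) : n = m + 1 -> cdiff X m n z = 0 -> cocycle z.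
Proof. by move=> ->. Qed.

Lemma coboundary_diff X i n (y : X i) : coboundary (cdiff X i n y).
Proof.
have [E|ni] := eqVneq n (i + 1); last first.
  by exists 0; rewrite linear0 cdiff_shape // lfunE.
have {}E : i = n - 1 by rewrite E addrK.
by subst i; exists y.
Qed.

Lemma coboundary_cocycle X n (z : X n) : coboundary z -> cocycle z.
Proof. by case=> y <-; apply: diffK. Qed.

Lemma coboundaryP X n (z : X n) :
  reflect (coboundary z) (z \in limg (cdiff X (n - 1) n)).
Proof.
apply: (iffP memv_imgP) => [[y _ ->]|[y <-]]; first by exists y.
by exists y; rewrite ?memvf.
Qed.

Lemma chmap_cocycle X Y (f : chmap X Y) n (z : X n) :
  cocycle z -> cocycle (f n z).
Proof. by rewrite /cocycle -chmapE => ->; rewrite linear0. Qed.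

Lemma chmap_coboundary X Y (f : chmap X Y) n (z : X n) :
  coboundary z -> coboundary (f n z).
Proof. by case=> y <-; rewrite chmapE; apply: coboundary_diff. Qed.

Lemma coboundary_sub X n : (limg (cdiff X (n - 1) n) <= lker (cdiff X n (n + 1)))%VS.
Proof.
by apply/subvP => z /coboundaryP/coboundary_cocycle zc; rewrite memv_ker zc.
Qed.

Lemma cohomology_cocycle X n z : z \in cohomology X n -> cocycle z.
Proof. by move/(subvP (diffvSl _ _)); rewrite memv_ker => /eqP. Qed.

Lemma cohomology_coboundary X n :
  (cohomology X n :&: limg (cdiff X (n - 1) n) = 0)%VS.
Proof. exact: capv_diff. Qed.

Lemma cocycle_split X n (z : X n) : cocycle z ->
  exists2 h, h \in cohomology X n & coboundary (z - h).
Proof.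
move=> zc; have : z \in (cohomology X n + limg (cdiff X (n - 1) n))%VS.
  rewrite addv_diff; apply: (subvP (addvSl _ _)).
  by rewrite memv_ker zc.
case/memv_addP => h hH [b /coboundaryP bB ->]; exists h => //.
by rewrite addrC addKr.
Qed.

Lemma acyclicP X n : acyclic_at X n <-> cohomology X n = 0%VS.
Proof.
split=> [ac|H0 z /cocycle_split[h]]; last first.
  by rewrite H0 memv0 => /eqP->; rewrite subr0.
apply/eqP; rewrite -subv0; apply/subvP => z zH.
rewrite -(cohomology_coboundary X n) memv_cap zH.
exact/coboundaryP/ac/cohomology_cocycle.
Qed.

(** The fragment of the long exact sequence in which the connecting map to
    [H^(n+1)(X) = 0] is trivial. *)
Lemma short_exact_connecting X Y Z (i : chmap X Y) (p : chmap Y Z) n :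
  short_exact i p -> acyclic_at X (n + 1) -> forall z : Z n, cocycle z ->
  exists2 y, cocycle y & p n y = z.
Proof.
move=> /short_exactP[ii sp pi ex] aX z zc; have [y yz] := sp n z.
have [|x ix] := ex (n + 1) (cdiff Y n (n + 1) y); first by rewrite chmapE yz.
have [|w wx] := aX x.
  by apply: (ii (n + 1 + 1)); rewrite chmapE ix diffK.
have nn : n + 1 - 1 = n by rewrite addrK.
move: w wx; rewrite nn => w wx; exists (y - i n w).
  by rewrite /cocycle linearB /= -chmapE wx ix subrr.
by rewrite linearB /= pi subr0.
Qed.

End Cohomology.

(** * Parity of the total Betti number *)

Lemma fsum_range (F : int -> nat) (a : int) (N : nat) :
  (forall n : int, n < a \/ a + N%:Z <= n -> F n = 0%N) ->
  (\sum_(n \in [set: int]%classic) F n = \sum_(i < N) F (a + i%:Z)%R)%N.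
Proof.
move=> F0; pose r := [seq a + i%:Z | i <- iota 0 N].
rewrite (fsbigE r) //.
- rewrite big_map -[X in iota _ X]subn0 big_mkord.
  by apply: eq_bigl => i; rewrite in_setT.
- by rewrite map_inj_uniq ?iota_uniq // => i j /addrI[].
- move=> n _ nr; case: (ltrP n a) => [na|an]; first by apply: F0; left.
  case: (lerP (a + N%:Z) n) => [nN|Nn]; first by apply: F0; right.
  case/mapP: nr; exists (absz (n - a)%R); rewrite ?mem_iota; lia.
Qed.

Section Parity.
Variable k : fieldType.
Implicit Types X Y Z : cochain k.

Definition tdim X : nat := (\sum_(n \in [set: int]%classic) \dim {: X n})%N.

(** Any larger window is allowed, so that several complexes can be given a
    common one. *)
Lemma cochain_range X : exists (a : int) (N : nat), forall (b : int) (M : nat),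
  b <= a -> a + N%:Z <= b + M%:Z -> forall n : int, n < b \/ b + M%:Z <= n ->
  \dim {: X n} = 0%N.
Proof.
have [a [b X0]] := cbounded X; exists a, (absz (b + 1 - a)%R) => c M ca h n hn.
apply: X0; apply/orP; lia.
Qed.

Lemma common_range X Y Z : exists (a : int) (N : nat), forall n : int,
  n < a \/ a + N%:Z <= n ->
  [/\ \dim {: X n} = 0%N, \dim {: Y n} = 0%N & \dim {: Z n} = 0%N].
Proof.
have [a1 [N1 h1]] := cochain_range X; have [a2 [N2 h2]] := cochain_range Y.
have [a3 [N3 h3]] := cochain_range Z.
pose a := Num.min a1 (Num.min a2 a3).
pose N := (absz (a1 - a)%R + absz (a2 - a)%R + absz (a3 - a)%R + N1 + N2 + N3)%N.
exists a, N => n hn; split.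
- by apply: h1 hn; rewrite /N /a; lia.
- by apply: h2 hn; rewrite /N /a; lia.
- by apply: h3 hn; rewrite /N /a; lia.
Qed.

Lemma dim_hom0l (U V : vectType k) (f : 'Hom(U, V)) : \dim {: U} = 0%N ->
  \dim (limg f) = 0%N.
Proof. by move=> U0; have := limg_ker_dim f fullv; lia. Qed.

(** Rank-nullity in each degree: the two ranks next to each cohomology group
    are counted twice in total, so the Betti number and the total dimension
    have the same parity. *)
Lemma odd_betti X : odd (betti X) = odd (tdim X).
Proof.
have [a [N h]] := common_range X X X.
have X0 n : n < a \/ a + N%:Z <= n -> \dim {: X n} = 0%N by case/h.
pose rk n : nat := \dim (limg (cdiff X n (n + 1))).
have dimE n : \dim {: X n} =
    (\dim (cohomology X n) + (\dim (limg (cdiff X (n - 1) n)) + rk n))%N.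
  rewrite cohomology_dim /rk -(limg_ker_dim (cdiff X n (n + 1)) fullv) capfv.
  by rewrite addnA (subnK (dimvS (coboundary_sub X n))).
have rkE n : \dim (limg (cdiff X (n - 1) n)) = rk (n - 1).
  by rewrite /rk subrK.
have F0 n : n < a \/ a + N.+1%:Z <= n -> \dim {: X n} = 0%N by move=> hn; apply: X0; lia.
rewrite /betti /tdim (fsum_range F0) (@fsum_range _ a N.+1); last first.
  by move=> n hn; have := dimE n; rewrite (F0 n hn); lia.
pose S : nat := (\sum_(i < N) rk (a + i%:Z)%R)%N.
have S1 : (\sum_(i < N.+1) \dim (limg (cdiff X (a + i%:Z - 1)%R (a + i%:Z)%R)) = S)%N.
  rewrite big_ord_recl (dim_hom0l (cdiff X (a + 0%:Z - 1) _)); last by apply: X0; lia.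
  by rewrite add0n; apply: eq_bigr => i _; rewrite rkE; congr rk; rewrite /= /bump; lia.
have S2 : (\sum_(i < N.+1) rk (a + i%:Z)%R = S)%N.
  by rewrite big_ord_recr /= [X in (_ + X)%N](dim_hom0l _) ?addn0 //; apply: X0; lia.
under [in RHS]eq_bigr do rewrite dimE.
by rewrite !big_split /= S1 S2 addnn oddD odd_double addbF.
Qed.

Lemma tdim_short_exact X Y Z (i : chmap X Y) (p : chmap Y Z) :
  short_exact i p -> tdim Y = (tdim X + tdim Z)%N.
Proof.
move=> se; have [a [N h]] := common_range X Y Z.
rewrite /tdim !(@fsum_range _ a N) -?big_split /=; try by move=> n /h[].
apply: eq_bigr => j _; have [ki ip rp] := se (a + j%:Z).
rewrite -(limg_ker_dim (p (a + j%:Z)) fullv) capfv rp -ip.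
by rewrite (limg_dim_eq (f := i (a + j%:Z))) // ki capv0.
Qed.

Lemma odd_short_exact X Y Z (i : chmap X Y) (p : chmap Y Z) :
  short_exact i p -> odd (betti Y) = odd (betti X) (+) odd (betti Z).
Proof. by move=> se; rewrite !odd_betti (tdim_short_exact se) oddD. Qed.

Lemma odd_dsum X Y : odd (betti (dsum X Y)) = odd (betti X) (+) odd (betti Y).
Proof. exact: odd_short_exact (dsum_short_exact X Y). Qed.

Lemma odd_stalk r (V : vectType k) : odd (betti (stalk r V)) = odd (\dim {: V}).
Proof.
rewrite odd_betti /tdim (@fsum_range _ r 1).
  by rewrite big_ord1 /= addr0 /stalk_term eqxx.
move=> n hn; rewrite /= /stalk_term ifF; first by rewrite dimvf /dim /= mul1n.
by apply/negP; lia.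
Qed.

Lemma acyclic_betti X : acyclic X -> betti X = 0%N.
Proof.
move=> aX; apply: fsbig1 => n _.
by have /acyclicP-> := aX n; rewrite dimv0.
Qed.

End Parity.

(** * Extensions and null-homotopies *)

Section Extensions.
Variable k : fieldType.
Implicit Types X Y Z W K : cochain k.

Definition pairmap X Y := forall i j : int, 'Hom(X i, Y j).

(** A degree-one map anticommuting with the differentials, i.e. a chain map
    from [X] to the shift of [Y]. *)
Definition one_cocycle X Y (phi : pairmap X Y) : Prop :=
  (forall i j, j != i + 1 -> phi i j = 0) /\
  (forall i j l x, cdiff Y j l (phi i j x) = - phi j l (cdiff X i j x)).

Definition null_homotopic X Y (phi : pairmap X Y) : Prop :=
  exists h : forall n, 'Hom(X n, Y n), forall i j x,
    phi i j x = cdiff Y i j (h i x) - h j (cdiff X i j x).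

Definition sandwich X0 X1 Y0 Y1 (g : chmap Y0 Y1) (phi : pairmap X1 Y0)
    (f : chmap X0 X1) : pairmap X0 Y1 :=
  fun i j => (g j \o (phi i j \o f i))%VF.

Lemma sandwichE X0 X1 Y0 Y1 (g : chmap Y0 Y1) (phi : pairmap X1 Y0)
    (f : chmap X0 X1) i j x : sandwich g phi f i j x = g j (phi i j (f i x)).
Proof. by rewrite !comp_lfunE. Qed.

Lemma sandwich_cocycle X0 X1 Y0 Y1 (g : chmap Y0 Y1) (phi : pairmap X1 Y0)
    (f : chmap X0 X1) : one_cocycle phi -> one_cocycle (sandwich g phi f).
Proof.
move=> [shp coc]; split=> [i j ij|i j l x].
  by rewrite /sandwich shp // comp_lfun0l comp_lfun0r.
by rewrite !sandwichE -chmapE coc linearN /= chmapE.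
Qed.

Lemma sandwich_null X0 X1 Y0 Y1 (g : chmap Y0 Y1) (phi : pairmap X1 Y0)
    (f : chmap X0 X1) : null_homotopic phi -> null_homotopic (sandwich g phi f).
Proof.
move=> [h hE]; exists (fun n => (g n \o (h n \o f n))%VF) => i j x.
by rewrite sandwichE hE !comp_lfunE linearB /= !chmapE.
Qed.

Lemma eq_null X Y (phi psi : pairmap X Y) :
  (forall i j x, phi i j x = psi i j x) ->
  null_homotopic phi -> null_homotopic psi.
Proof. by move=> E [h hE]; exists h => i j x; rewrite -E hE. Qed.

(** Writing [D] for a generalized inverse of [d], every complex of vector
    spaces splits as coboundaries, plus a complement of them in the cocycles,
    plus the image of [D].  On these pieces the homotopy is [- phi D],
    [D phi] and [0] respectively. *)
Lemma one_cocycle_null X Y (phi : pairmap X Y) : one_cocycle phi ->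
  (forall n (z : X n), cocycle z -> coboundary (phi n (n + 1) z)) ->
  null_homotopic phi.
Proof.
move=> [shp coc] phiB.
(* the neighbouring degrees [a = n - 1] and [b = n + 1] are arguments so that
   they can be rewritten freely *)
pose piZ n b : 'Hom(X n, X n) := (\1 - ((cdiff X n b)^-1 \o cdiff X n b))%VF.
pose piH a n : 'Hom(X n, X n) := (\1 - (cdiff X a n \o (cdiff X a n)^-1))%VF.
pose H a n b : 'Hom(X n, Y n) :=
  ((((cdiff Y n b)^-1 \o (phi n b \o piH a n)) - (phi a n \o (cdiff X a n)^-1))
     \o piZ n b)%VF.
have HE a n b x : H a n b x =
    (cdiff Y n b)^-1%VF (phi n b (piH a n (piZ n b x)))
    - phi a n ((cdiff X a n)^-1%VF (piZ n b x)).
  by rewrite /H comp_lfunE add_lfunE opp_lfunE !comp_lfunE.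
have piZE n b x : piZ n b x = x - (cdiff X n b)^-1%VF (cdiff X n b x).
  by rewrite /piZ add_lfunE opp_lfunE comp_lfunE id_lfunE.
have piHE a n x : piH a n x = x - cdiff X a n ((cdiff X a n)^-1%VF x).
  by rewrite /piH add_lfunE opp_lfunE comp_lfunE id_lfunE.
have dDd W n b x : cdiff W n b ((cdiff W n b)^-1%VF (cdiff W n b x)) = cdiff W n b x.
  by apply: limg_lfunVK; rewrite memv_img ?memvf.
have piZc n b x : cdiff X n b (piZ n b x) = 0.
  by rewrite piZE linearB /= dDd subrr.
have piZd i j l x : piZ j l (cdiff X i j x) = cdiff X i j x.
  by rewrite piZE diffK linear0 subr0.
(* [d H = phi] on cocycles *)
have dH n b z : b = n + 1 -> cdiff Y n b (H (n - 1) n b z) = phi n b (piZ n b z).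
  move=> bE; rewrite HE linearB /= coc piHE.
  set z' := piZ n b z; set w := (cdiff X (n - 1) n)^-1%VF z'.
  have z'c : cdiff X n b (z' - cdiff X (n - 1) n w) = 0.
    by rewrite linearB /= diffK piZc subr0.
  rewrite (limg_lfunVK (x := phi n b _)); last first.
    have [y <-] : exists y, cdiff Y n b y = phi n b (z' - cdiff X (n - 1) n w).
      subst b; have [y <-] := phiB n _ z'c.
      by move: y; rewrite addrK => y; exists y.
    by rewrite memv_img ?memvf.
  by rewrite linearB /= opprK subrK.
exists (fun n => H (n - 1) n (n + 1)) => i j x.
have [jE|nij] := eqVneq j (i + 1); last first.
  by rewrite shp // !cdiff_shape // !lfunE linear0 subr0.
have -> : H (j - 1) j (j + 1) = H i j (j + 1) by rewrite jE addrK.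
rewrite -jE dH // HE piZd piHE dDd subrr !linear0 sub0r opprK.
by rewrite -linearD /= piZE subrK.
Qed.

(** In this situation [Ext^1(X, Y)], the product over [n] of the spaces of
    linear maps from [H^n(X)] to [H^(n+1)(Y)], vanishes. *)
Definition orth X Y := forall n, acyclic_at X n \/ acyclic_at Y (n + 1).

(** A cocycle in degree [n] is a coboundary in the first case; in the second
    its image is a cocycle in degree [n + 1], hence a coboundary. *)
Lemma orth_null X Y (phi : pairmap X Y) : orth X Y -> one_cocycle phi ->
  null_homotopic phi.
Proof.
move=> oXY phic; apply: one_cocycle_null => // n z zc.
case: (oXY n) => [/(_ z zc)[y <-]|]; last first.
  by apply; rewrite /cocycle phic.2 zc linear0 oppr0.
have -> : phi n (n + 1) (cdiff X (n - 1) n y) = cdiff Y n (n + 1) (- phi (n - 1) n y).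
  by rewrite linearN /= phic.2 opprK.
exact: coboundary_diff.
Qed.

Lemma orth_acyclicl X Y : acyclic X -> orth X Y.
Proof. by move=> aX n; left. Qed.
Lemma orth_acyclicr X Y : acyclic Y -> orth X Y.
Proof. by move=> aY n; right. Qed.

(** [phi] measures the failure of the degreewise section [s] of [p] to be a
    chain map; it represents the class of the extension [(i, p)]. *)
Definition ext_cocycle X Y Z (i : chmap X Y) (p : chmap Y Z)
    (s : forall n, 'Hom(Z n, Y n)) (phi : pairmap Z X) : Prop :=
  (forall n z, p n (s n z) = z) /\
  (forall a b z, i b (phi a b z) = cdiff Y a b (s a z) - s b (cdiff Z a b z)).

Lemma section_cocycle X Y Z (i : chmap X Y) (p : chmap Y Z)
    (s : forall n, 'Hom(Z n, Y n)) : short_exact i p ->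
  (forall n z, p n (s n z) = z) -> exists phi, ext_cocycle i p s phi.
Proof.
move=> /short_exactP[ii sp pi ex] ps.
exists (fun a b => (i b)^-1 \o ((cdiff Y a b \o s a) - (s b \o cdiff Z a b)))%VF.
split=> // a b z; rewrite comp_lfunE add_lfunE opp_lfunE !comp_lfunE.
have [|x <-] := ex b (cdiff Y a b (s a z) - s b (cdiff Z a b z)).
  by rewrite linearB /= chmapE !ps subrr.
by rewrite injK.
Qed.

Lemma ext_cocycle_exists X Y Z (i : chmap X Y) (p : chmap Y Z) :
  short_exact i p -> exists s phi, ext_cocycle i p s phi.
Proof.
move=> se; have /short_exactP[_ sp _ _] := se.
have [phi phiE] := section_cocycle se (surjK sp).
by exists (fun n => (p n)^-1%VF), phi.
Qed.

Lemma ext_cocycleP X Y Z (i : chmap X Y) (p : chmap Y Z) s phi :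
  short_exact i p -> ext_cocycle i p s phi -> one_cocycle phi.
Proof.
move=> /short_exactP[ii _ _ _] [ps phiE]; split=> [a b ab|a b c x].
  by apply/lfunP => z; apply: (injP ii); rewrite phiE !cdiff_shape // !lfunE /= !linear0 addr0.
apply: (injP ii); rewrite linearN /= chmapE !phiE linearB /= !diffK.
by rewrite linear0 subr0 add0r.
Qed.

(** The lift of [f] is [s f] corrected by the homotopy. *)
Lemma null_lift X Y Z W (i : chmap X Y) (p : chmap Y Z) s phi (f : chmap W Z) :
  short_exact i p -> ext_cocycle i p s phi ->
  null_homotopic (sandwich (chmap_id X) phi f) ->
  exists g : chmap W Y, chmap_comp p g = f.
Proof.
move=> /short_exactP[_ _ pi _] [ps phiE] [h hE].
have [a b x|g gE] := @chmap_intro k W Y (fun n => (s n \o f n) - (i n \o h n))%VF.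
  have := hE a b x; rewrite sandwichE chmap_idE => /(congr1 (i b)).
  rewrite phiE linearB /= !chmapE => /(canRL (subrK _)) E.
  rewrite !add_lfunE !opp_lfunE !comp_lfunE linearB /= !chmapE E.
  by rewrite [RHS]addrAC [X in _ = X + _]addrAC subrr add0r addrC.
exists g; apply: chmap_ext => n x.
by rewrite chE gE add_lfunE opp_lfunE !comp_lfunE linearB /= pi ps subr0.
Qed.

(** Here the degreewise retraction [t] attached to the section [s] fails to be
    a chain map by [- phi p], which the homotopy absorbs. *)
Lemma null_extend X Y Z W (i : chmap X Y) (p : chmap Y Z) s phi (g : chmap X W) :
  short_exact i p -> ext_cocycle i p s phi ->
  null_homotopic (sandwich g phi (chmap_id Z)) ->
  exists u : chmap Y W, chmap_comp u i = g.
Proof.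
move=> /short_exactP[ii sp pi ex] [ps phiE] [h hE].
pose t n : 'Hom(Y n, X n) := ((i n)^-1 \o (\1 - (s n \o p n)))%VF.
have it n y : i n (t n y) = y - s n (p n y).
  rewrite /t comp_lfunE add_lfunE opp_lfunE id_lfunE comp_lfunE.
  have [|x <-] := ex n (y - s n (p n y)); first by rewrite linearB /= ps subrr.
  by rewrite injK.
have ti n x : t n (i n x) = x.
  by apply: (injP ii); rewrite it pi linear0 subr0.
have td a b y : t b (cdiff Y a b y) = cdiff X a b (t a y) + phi a b (p a y).
  apply: (injP ii); rewrite linearD /= it !chmapE it phiE linearB /=.
  by rewrite addrA subrK.
clearbody t.
have [a b y|u uE] := @chmap_intro k Y W (fun n => (g n \o t n) + (h n \o p n))%VF.
  have := hE a b (p a y); rewrite sandwichE chmap_idE => E.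
  rewrite !add_lfunE !comp_lfunE td !linearD /= E !chmapE.
  by rewrite -addrA subrK.
exists u; apply: chmap_ext => n x.
by rewrite chE uE add_lfunE !comp_lfunE pi linear0 addr0 ti.
Qed.

Lemma orth_lift X Y Z W (i : chmap X Y) (p : chmap Y Z) (f : chmap W Z) :
  short_exact i p -> orth W X -> exists g : chmap W Y, chmap_comp p g = f.
Proof.
move=> se oWX; have [s [phi phiE]] := ext_cocycle_exists se.
apply: (null_lift se phiE); apply: orth_null => //.
exact/sandwich_cocycle/(ext_cocycleP se phiE).
Qed.

Lemma orth_extend X Y Z W (i : chmap X Y) (p : chmap Y Z) (g : chmap X W) :
  short_exact i p -> orth Z W -> exists u : chmap Y W, chmap_comp u i = g.
Proof.
move=> se oZW; have [s [phi phiE]] := ext_cocycle_exists se.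
apply: (null_extend se phiE); apply: orth_null => //.
exact/sandwich_cocycle/(ext_cocycleP se phiE).
Qed.

(** The section of the middle extension is corrected by elements of [Y0] so
    as to lie over that of the first one; no universal property of the two
    squares is needed for this. *)
Lemma ext_cocycle_map X0 X1 Y0 Y1 E E' E'' (f : chmap X0 X1) (g : chmap Y0 Y1)
    (i : chmap Y0 E) (p : chmap E X1) (i' : chmap Y0 E') (p' : chmap E' X0)
    (i'' : chmap Y1 E'') (p'' : chmap E'' X0)
    (h : chmap E' E) (h' : chmap E' E'') s phi :
  short_exact i p -> short_exact i' p' -> ext_cocycle i p s phi ->
  chmap_comp p h = chmap_comp f p' -> chmap_comp h i' = i ->
  chmap_comp i'' g = chmap_comp h' i' -> chmap_comp p'' h' = p' ->
  exists s'', ext_cocycle i'' p'' s'' (sandwich g phi f).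
Proof.
move=> se se' [ps phiE] ph hi ig ph'.
have /short_exactP[ii _ pi ex] := se; have /short_exactP[ii' sp' pi' ex'] := se'.
have hi_ n x : h n (i' n x) = i n x by rewrite -chmap_compE hi.
have ph_ n x : p n (h n x) = f n (p' n x) by rewrite -!chmap_compE ph.
have ig_ n x : i'' n (g n x) = h' n (i' n x) by rewrite -!chmap_compE ig.
have ph'_ n x : p'' n (h' n x) = p' n x by rewrite -!chmap_compE ph'.
pose s0 n : 'Hom(X0 n, E' n) := (p' n)^-1%VF.
pose s' n : 'Hom(X0 n, E' n) :=
  (s0 n - (i' n \o ((i n)^-1 \o ((h n \o s0 n) - (s n \o f n)))))%VF.
have ps' n x : p' n (s' n x) = x.
  by rewrite add_lfunE opp_lfunE comp_lfunE linearB /= pi' subr0 /s0 surjK.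
have hs' n x : h n (s' n x) = s n (f n x).
  rewrite add_lfunE opp_lfunE !comp_lfunE add_lfunE opp_lfunE !comp_lfunE.
  rewrite linearB /= hi_.
  have [|y yE] := ex n (h n (s0 n x) - s n (f n x)).
    by rewrite linearB /= ph_ ps /s0 surjK // subrr.
  by rewrite -yE injK // yE opprB addrC subrK.
clearbody s'.
exists (fun n => (h' n \o s' n)%VF); split=> [n x|a b x].
  by rewrite comp_lfunE ph'_ ps'.
rewrite sandwichE !comp_lfunE ig_ -!chmapE -linearB /=; congr (h' b _).
have [|y yE] := ex' b (cdiff E' a b (s' a x) - s' b (cdiff X0 a b x)).
  by rewrite linearB /= chmapE !ps' subrr.
rewrite -yE; congr (i' b _); apply: (injP ii).
by rewrite -(hi_ b y) yE linearB /= chmapE !hs' chmapE phiE.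
Qed.

End Extensions.

(** * Quasi-isomorphisms and acyclic covers and hulls *)

Section Approximation.
Variable k : fieldType.
Implicit Types X Y Z W K : cochain k.

Lemma dim0_eq0 (V : vectType k) (v : V) : \dim {: V} = 0%N -> v = 0.
Proof.
move/eqP; rewrite dimv_eq0 => /eqP V0; apply/eqP.
by rewrite -memv0 -V0 memvf.
Qed.

Lemma dim0_acyclic X n : \dim {: X n} = 0%N -> acyclic_at X n.
Proof. by move=> X0 z _; exists 0; rewrite linear0 (dim0_eq0 z X0). Qed.

Lemma dim_stalk0 r (V : vectType k) n : n != r -> \dim {: stalk r V n} = 0%N.
Proof.
by move=> nr; rewrite /= /stalk_term (negPf nr) dimvf /dim /= mul1n.
Qed.

Lemma stalk_acyclic r (V : vectType k) n : n != r -> acyclic_at (stalk r V) n.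
Proof. by move=> nr; apply/dim0_acyclic/dim_stalk0. Qed.

Lemma retract_acyclic X Y (f : chmap X Y) (g : chmap Y X) n :
  chmap_comp g f = chmap_id X -> acyclic_at Y n -> acyclic_at X n.
Proof.
move=> gf aY z zc; have gfE m x : g m (f m x) = x by rewrite -chmap_compE gf chmap_idE.
rewrite -(gfE n z); apply: chmap_coboundary; apply: aY; exact: chmap_cocycle.
Qed.

Lemma dsum_acyclic X Y n : acyclic_at X n -> acyclic_at Y n ->
  acyclic_at (dsum X Y) n.
Proof.
move=> aX aY u uc; have [x xE] := aX _ (chmap_cocycle prl uc).
have [y yE] := aY _ (chmap_cocycle prr uc).
exists (dinl (n - 1) x + dinr (n - 1) y).
by rewrite homD -!chmapE xE yE -dsum_decomp.
Qed.

Definition quasi_iso X Y (f : chmap X Y) := forall n,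
  (forall z, cocycle z -> coboundary (f n z) -> coboundary z) /\
  (forall w : Y n, cocycle w -> exists2 z, cocycle z & coboundary (w - f n z)).

(** With cohomology encoded by complements there is no map between the
    cohomology spaces to speak of, so their dimensions are compared by counting
    cocycles and coboundaries. *)
Lemma quasi_iso_betti X Y (f : chmap X Y) : quasi_iso f -> betti X = betti Y.
Proof.
move=> qf; apply: eq_fsbigr => n _; have [fi fs] := qf n.
rewrite !cohomology_dim.
set ZX := lker _; set BX := limg (cdiff X _ _).
set ZY := lker (cdiff Y _ _); set BY := limg (cdiff Y _ _).
have cZX z : reflect (cocycle z) (z \in ZX) by rewrite memv_ker; apply: eqP.
have cZY z : reflect (cocycle z) (z \in ZY) by rewrite memv_ker; apply: eqP.
have sX : (BX <= ZX)%VS := coboundary_sub X n.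
have sY : (BY <= ZY)%VS := coboundary_sub Y n.
have addE : (f n @: ZX + BY = ZY)%VS.
  apply/eqP; rewrite eqEsubv subv_add sY andbT; apply/andP; split.
    by apply/subvP => _ /memv_imgP[z /cZX zc ->]; apply/cZY/chmap_cocycle.
  apply/subvP => w /cZY/fs[z zc wz]; rewrite -(subrK (f n z) w) addrC.
  by rewrite memv_add ?memv_img //; [apply/cZX | apply/coboundaryP].
have capE : (f n @: ZX :&: BY = f n @: BX)%VS.
  apply/vspaceP => w; rewrite memv_cap; apply/andP/idP => [[]|].
    move=> /memv_imgP[z /cZX zc ->] /coboundaryP wb.
    by rewrite memv_img //; apply/coboundaryP/fi.
  move/memv_imgP => [z zB ->]; split; first by rewrite memv_img ?(subvP sX).
  by apply/coboundaryP/chmap_coboundary/coboundaryP.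
have kerE : (ZX :&: lker (f n) = BX :&: lker (f n))%VS.
  apply/vspaceP => z; rewrite !memv_cap.
  apply/andP/andP => -[zX zf]; split=> //; last exact: (subvP sX).
  apply/coboundaryP/fi; first exact/cZX.
  by move: zf; rewrite memv_ker => /eqP->; exists 0; rewrite linear0.
have := dimv_sum_cap (f n @: ZX) BY; rewrite addE capE.
have := limg_ker_dim (f n) ZX; have := limg_ker_dim (f n) BX; rewrite kerE.
have := dimvS sX; have := dimvS sY.
move: (\dim ZX) (\dim BX) (\dim ZY) (\dim BY) (\dim _) (\dim _) (\dim _).
by lia.
Qed.

Section Disk.
Variable V : int -> vectType k.

(** The identity of [V i], read as a map to [V j] when [i = j]; this is how
    terms in degrees such as [n] and [n - 1 + 1] are compared. *)
Definition icast (i j : int) : 'Hom(V i, V j) :=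
  if i =P j is ReflectT e then ecast j ('Hom(V i, V j)) e \1%VF else 0.

Lemma icast_id i x : icast i i x = x.
Proof.
by rewrite /icast; case: eqP => // e; rewrite (eq_axiomK e) /= id_lfunE.
Qed.

Lemma icast_neq i j : i != j -> icast i j = 0.
Proof. by rewrite /icast; case: eqP. Qed.

Lemma icastK i j x : i = j -> icast j i (icast i j x) = x.
Proof. by move=> ij; subst j; rewrite !icast_id. Qed.

Hypothesis V_bounded : exists a b : int, forall n : int, (n < a) || (b < n) ->
  \dim {: V n} = 0%N.

(** The sum over [n] of the complexes [V n = V n] placed in degrees [n] and
    [n + 1]. *)
Definition disk_term n : vectType k := (V (n - 1) * V n)%type.
Definition disk_fun i j (u : disk_term i) : disk_term j := (icast i (j - 1) u.2, 0).

Fact disk_linear i j : linear (@disk_fun i j).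
Proof.
move=> a u v; congr pair; first by rewrite /= linearP.
exact: (esym (etrans (addr0 _) (scaler0 _ _))).
Qed.
HB.instance Definition _ i j :=
  GRing.isLinear.Build k (disk_term i) (disk_term j) _ (@disk_fun i j)
    (@disk_linear i j).

Definition disk_diff i j : 'Hom(disk_term i, disk_term j) := linfun (@disk_fun i j).

Lemma disk_diffE i j u : disk_diff i j u = (icast i (j - 1) u.2, 0).
Proof. by rewrite lfunE. Qed.

Fact disk_shape i j : j != i + 1 -> disk_diff i j = 0.
Proof.
move=> ij; apply/lfunP => u; rewrite disk_diffE icast_neq ?lfunE //.
by apply: contra ij => /eqP->; rewrite subrK.
Qed.

Fact disk_sq i j l : (disk_diff j l \o disk_diff i j)%VF = 0.
Proof.
by apply/lfunP => u; rewrite comp_lfunE !disk_diffE /= linear0 lfunE.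
Qed.

Fact disk_bounded : exists a b : int, forall n : int, (n < a) || (b < n) ->
  \dim {: disk_term n} = 0%N.
Proof.
have [a [b V0]] := V_bounded; exists a, (b + 1) => n hn.
have -> : \dim {: disk_term n} = (\dim {: V (n - 1)} + \dim {: V n})%N by rewrite !dimvf.
by rewrite !V0 //; apply/orP; move/orP: hn; lia.
Qed.

Definition disk : cochain k := Cochain disk_shape disk_sq disk_bounded.

Lemma disk_acyclic : acyclic disk.
Proof.
move=> n [a b]; rewrite /cocycle /= disk_diffE /= => -[ib0].
exists (0, a); rewrite /= disk_diffE /= icast_id.
by congr pair; rewrite -(icastK b (esym (addrK 1 n))) ib0 linear0.
Qed.
End Disk.

Lemma icast_diff X i j l x : l = j -> icast X j l (cdiff X i j x) = cdiff X i l x.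
Proof. by move=> ->; rewrite icast_id. Qed.

Lemma diff_icast X i j l x : i = j -> cdiff X j l (icast X i j x) = cdiff X i l x.
Proof. by move=> <-; rewrite icast_id. Qed.

(** A pair [(y, x)] is sent to [d y + x]. *)
Lemma disk_cover X : exists P (p : chmap P X), acyclic P /\ surj p.
Proof.
pose P := disk (cbounded X).
pose pr1 n : 'Hom(P n, X (n - 1)) := linfun (@fst (X (n - 1)) (X n)).
pose pr2 n : 'Hom(P n, X n) := linfun (@snd (X (n - 1)) (X n)).
have pr1E n u : pr1 n u = u.1 by rewrite lfunE.
have pr2E n u : pr2 n u = u.2 by rewrite lfunE.
have [i j u|p pE] := @chmap_intro k P X
    (fun n => (cdiff X (n - 1) n \o pr1 n) + pr2 n)%VF.
  rewrite !add_lfunE !comp_lfunE !pr1E !pr2E /= !disk_diffE /= addr0 linearD /=.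
  rewrite diffK add0r; have [jE|ij] := eqVneq j (i + 1).
    by rewrite diff_icast // jE addrK.
  rewrite icast_neq ?lfunE ?linear0 ?cdiff_shape ?lfunE //.
  by apply: contra ij => /eqP->; rewrite subrK.
exists P, p; split=> [|n x]; first exact: disk_acyclic.
by exists (0, x); rewrite pE add_lfunE comp_lfunE pr1E pr2E /= linear0 add0r.
Qed.

(** The shifted disk on the terms of [X], into which [x] goes as [(x, d x)]. *)
Lemma disk_hull X : exists I (i : chmap X I), acyclic I /\ inj i.
Proof.
have Vb : exists a b : int, forall n : int, (n < a) || (b < n) ->
    \dim {: X (n + 1)} = 0%N.
  have [a [b X0]] := cbounded X; exists (a - 1), b => n hn; apply: X0.
  by apply/orP; move/orP: hn; lia.
pose I := disk Vb.
pose F n (x : X n) : I n :=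
  (icast X n (n - 1 + 1) x, cdiff X n (n + 1) x).
have Fl n : linear (@F n) by move=> a x y; congr pair; rewrite linearP.
pose G n : 'Hom(X n, I n) :=
  linfun (HB.pack (@F n) (GRing.isLinear.Build k (X n) (I n) _ (@F n) (Fl n))
    : {linear X n -> I n}).
have GE n x : G n x = F n x by rewrite lfunE.
have [i j x|f fE] := @chmap_intro k X I G.
  rewrite !GE /= disk_diffE /F /= diffK; congr pair.
  have [jE|ij] := eqVneq j (i + 1); last first.
    rewrite (icast_neq (fun n => X (n + 1))) ?lfunE; last first.
      by apply: contra ij => /eqP->; rewrite subrK.
    by rewrite cdiff_shape // lfunE linear0.
  subst j; rewrite icast_diff ?subrK //.
  have : i = i + 1 - 1 by rewrite addrK.
  by move: (i + 1 - 1) => l <-; rewrite (@icast_id (fun n => X (n + 1))).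
exists I, f; split=> [|n x]; first exact: disk_acyclic.
rewrite fE GE => -[x0 _]; have {}x0 : icast X n (n - 1 + 1) x = 0 := x0.
by rewrite -(icastK (V := X) x (esym (subrK 1 n))) x0 linear0.
Qed.

End Approximation.

(** * Approximations in the category of all bounded complexes *)

Section Truncation.
Variable k : fieldType.
Implicit Types X Y Z W K : cochain k.
Variable S : pred int.

(** The cohomology in the degrees of [S], as a complex with zero
    differential.  Over a field it plays the part of both truncations of [X]:
    it maps to [X] and [X] maps to it. *)
Definition part_space X n : {vspace X n} := if S n then cohomology X n else 0%VS.
Definition part_term X n : vectType k := subvs_of (part_space X n).

Fact part_bounded X : exists a b : int, forall n : int, (n < a) || (b < n) ->
  \dim {: part_term X n} = 0%N.
Proof.
have [a [b X0]] := cbounded X; exists a, b => n /X0 Xn.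
by rewrite dimvf; apply/eqP; rewrite -leqn0 -Xn dimvS ?subvf.
Qed.

Definition part X : cochain k :=
  @Cochain k (part_term X) (fun i j => 0) (fun i j _ => erefl)
    (fun i j l => comp_lfun0l _ _) (part_bounded X).

Lemma part_diff X i j x : cdiff (part X) i j x = 0.
Proof. exact: lfunE. Qed.

Lemma part_acyclic X n : ~~ S n -> acyclic_at (part X) n.
Proof.
move=> nS; apply: dim0_acyclic.
by rewrite dimvf /= /part_term /part_space (negPf nS) /dim /= dimv0.
Qed.

Lemma part_space_cocycle X n z : z \in part_space X n -> cocycle z.
Proof.
rewrite /part_space; case: (S n) => [|z0]; first exact: cohomology_cocycle.
by move: z0; rewrite memv0 => /eqP->; apply: linear0.
Qed.

Lemma part_space_coboundary X n :
  (part_space X n :&: limg (cdiff X (n - 1) n) = 0)%VS.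
Proof.
by rewrite /part_space; case: (S n); rewrite ?cap0v ?cohomology_coboundary.
Qed.

Lemma part_maps X : exists (c : chmap (part X) X) (q : chmap X (part X)),
  chmap_comp q c = chmap_id (part X) /\
  (forall n x, c n x \in part_space X n) /\
  (forall n z, S n -> cocycle z -> coboundary (z - c n (q n z))).
Proof.
pose F n : 'Hom(part X n, X n) := linfun (@vsval k (X n) (part_space X n)).
pose B n := limg (cdiff X (n - 1) n).
pose G n : 'Hom(X n, part X n) :=
  (linfun (@vsproj k (X n) (part_space X n)) \o daddv_pi (part_space X n) (B n))%VF.
have FE n x : F n x = vsval x by rewrite lfunE.
have FG n z : F n (G n z) = daddv_pi (part_space X n) (B n) z.
  by rewrite FE /G comp_lfunE lfunE /= vsprojK ?memv_pi.
have FI n x y : F n x = F n y -> x = y by rewrite !FE => /val_inj.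
have GB n z : coboundary z -> G n z = 0.
  move/coboundaryP => zB; apply: FI; rewrite FG linear0.
  have zz : daddv_pi (B n) (part_space X n) z = z.
    by rewrite daddv_pi_id // capvC part_space_coboundary.
  have := daddv_pi_add (part_space_coboundary X n) (subvP (addvSr _ _) _ zB).
  by rewrite zz => /(canRL (addrK _)); rewrite subrr.
have [i j x|c cE] := @chmap_intro k (part X) X F.
  rewrite part_diff linear0; apply/esym/cocycleP/(@part_space_cocycle X i).
  by rewrite FE subvsP.
have [i j x|q qE] := @chmap_intro k X (part X) G.
  by rewrite part_diff GB //; apply: coboundary_diff.
exists c, q; split; [|split].
- apply: chmap_ext => n x; rewrite !chE cE qE; apply: FI.
  by rewrite FG daddv_pi_id ?part_space_coboundary // FE subvsP.
- by move=> n x; rewrite cE FE subvsP.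
- move=> n z Sn zc; rewrite qE cE FG.
  have zD : z \in (part_space X n + B n)%VS.
    rewrite /part_space Sn addv_diff; apply: (subvP (addvSl _ _)).
    by rewrite memv_ker zc.
  rewrite -{1}(daddv_pi_add (part_space_coboundary X n) zD) addrC addKr.
  exact/coboundaryP/memv_pi.
Qed.

End Truncation.

Section Approximation.
Variable k : fieldType.
Implicit Types X Y Z W K : cochain k.

Definition coh_le0 X := forall n : int, 1 <= n -> acyclic_at X n.
Definition coh_ge2 X := forall n : int, n <= 1 -> acyclic_at X n.

Lemma orth_le0_ge2 X Y : coh_le0 X -> coh_ge2 Y -> orth X Y.
Proof.
move=> hX lY n; case: (lerP 1 n) => n1; [left; exact: hX | right; apply: lY; lia].
Qed.

(** The nonpositive cohomology maps to [X]; adding an acyclic complex makes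
    the map surjective, and the long exact sequence locates the cohomology of
    the kernel in degrees at least two. *)
Lemma precover_exists X : exists K L (i : chmap K L) (p : chmap L X),
  [/\ short_exact i p, coh_le0 L & coh_ge2 K].
Proof.
have [P [r [aP sr]]] := disk_cover X.
have [c [q [qc [cin cq]]]] := part_maps (fun n : int => n <= 0) X.
set T := part _ _ in c q qc cin cq.
pose p : chmap (dsum T P) X := chmap_comp c prl + chmap_comp r prr.
have pE n u : p n u = c n (prl n u) + r n (prr n u) by rewrite /p !chE.
have pinl n z : p n (dinl n z) = c n z by rewrite pE !dsK linear0 addr0.
have pinr n y : p n (dinr n y) = r n y by rewrite pE !dsK linear0 add0r.
have sp : surj p.
  by move=> n x; have [y yx] := sr n x; exists (dinr n y); rewrite pinr.
have [K [i [ii pi ex]]] := kernel_complex p.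
have se : short_exact i p by apply/short_exactP.
have hT : coh_le0 T by move=> n n1; apply: part_acyclic; rewrite -ltNge; lia.
exists K, _, i, p; split=> // [n n1|n n1 x xc].
  by apply: dsum_acyclic => //; apply: hT.
(* [p] is injective on cohomology, since [part X -> X] is and [P] has none *)
have iB : coboundary (i n x).
  have cB : coboundary (c n (prl n (i n x))).
    have : p n (i n x) = 0 := pi n x.
    rewrite pE => /(canRL (addrK _)); rewrite sub0r => ->.
    have /aP[y <-] : cocycle (prr n (i n x)) by do 2!apply: chmap_cocycle.
    by exists (- r _ y); rewrite linearN /= -chmapE.
  have l0 : prl n (i n x) = 0.
    rewrite -(chmap_idE (prl n (i n x))) -qc chE.
    have /eqP-> : c n (prl n (i n x)) == 0; last by rewrite linear0.
    rewrite -memv0 -(part_space_coboundary (fun n : int => n <= 0) X n) memv_cap cin.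
    exact/coboundaryP.
  have /aP[y yE] : cocycle (prr n (i n x)) by do 2!apply: chmap_cocycle.
  exists (dinr _ y); rewrite -chmapE yE [i n x in RHS]dsum_decomp l0.
  by rewrite linear0 add0r.
have [e eE] := iB.
have pec : cocycle (p (n - 1) e).
  by apply: (cocycle_succ (n := n)); rewrite ?subrK // -chmapE eE pi.
have [|b bE] := cq (n - 1) _ _ pec; first by rewrite /=; lia.
(* [e] is corrected by a cocycle and a coboundary so as to lie in the kernel *)
have [b' b'E] := sr _ b.
pose e' := e - dinl _ (q _ (p _ e)) - cdiff (dsum T P) _ _ (dinr _ b').
have [|y yE] := ex _ e'.
  by rewrite /e' !homB chmapE pinl pinr b'E bE subrr.
exists y; apply: (injP ii); rewrite chmapE yE /e' !homB diffK subr0 eE -chmapE.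
by rewrite part_diff linear0 subr0.
Qed.

(** Dually, [X] maps to its cohomology in degrees at least two. *)
Lemma preenvelope_exists X : exists D G (j : chmap X D) (q : chmap D G),
  [/\ short_exact j q, coh_ge2 D & coh_le0 G].
Proof.
have [I [r [aI ir]]] := disk_hull X.
have [c [q [qc [cin cq]]]] := part_maps (fun n : int => 2 <= n) X.
set T := part _ _ in c q qc cin cq.
pose j : chmap X (dsum T I) := chmap_comp dinl q + chmap_comp dinr r.
have jE n x : j n x = dinl n (q n x) + dinr n (r n x) by rewrite /j !chE.
have prlj n x : prl n (j n x) = q n x by rewrite jE homD !dsK addr0.
have prrj n x : prr n (j n x) = r n x by rewrite jE homD !dsK add0r.
have ij : inj j by move=> n x jx0; apply: (ir n); rewrite -prrj jx0 linear0.
have [G [g [sg gj ex]]] := cokernel_complex j.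
have se : short_exact j g by apply/short_exactP.
exists _, G, j, g; split=> // [n n1|n n1 w wc].
  apply: dsum_acyclic => //; apply: part_acyclic; rewrite -ltNge; lia.
have [e eE] := sg n w.
have [|x xE] := ex (n + 1) (cdiff _ n (n + 1) e); first by rewrite chmapE eE.
have xc : cocycle x by apply: (injP ij); rewrite chmapE xE diffK linear0.
have qx : q (n + 1) x = 0 by rewrite -prlj xE chmapE part_diff.
have [|b] := cq (n + 1) x _ xc; first by rewrite /=; lia.
rewrite qx linear0 subr0; move: b; rewrite [n + 1 - 1](addrK 1 n) => b bE.
pose z := c n (prl n (e - j n b)).
have zc : cocycle z by apply: chmap_cocycle; apply: part_diff.
have qz : q n z = prl n (e - j n b) by rewrite /z -[q n _]chmap_compE qc chmap_idE.
clearbody z; pose e' := e - j n b - j n z.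
have e'l : prl n e' = 0.
  by rewrite /e' homB prlj qz subrr.
have e'c : cocycle e'.
  by rewrite /cocycle /e' !homB -!chmapE bE xE zc linear0 subr0 subrr.
have [y yE] := aI _ _ (chmap_cocycle prr e'c).
exists (g _ (dinr _ y)); rewrite -!chmapE yE.
have -> : dinr n (prr n e') = e' by rewrite [e' in RHS]dsum_decomp e'l linear0 add0r.
by rewrite /e' !homB !gj !subr0.
Qed.

End Approximation.

(** * Pullbacks and pushouts of short exact sequences *)

Section Squares.
Variable k : fieldType.
Implicit Types X Y Z W K : cochain k.

(** [P] is the kernel of [(f, - p)] on the direct sum, and [i'] identifies the
    kernel of [q] with that of [p]. *)
Lemma pullback_complex X Y Z K (f : chmap X Z) (i : chmap K Y) (p : chmap Y Z) :
  short_exact i p ->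
  exists P (q : chmap P X) (g : chmap P Y) (i' : chmap K P),
  [/\ short_exact i' q, chmap_comp g i' = i, chmap_comp f q = chmap_comp p g &
    forall W (a : chmap W X) (b : chmap W Y),
      chmap_comp f a = chmap_comp p b ->
      exists u : chmap W P, chmap_comp q u = a /\ chmap_comp g u = b].
Proof.
move=> /short_exactP[ii sp pi ex].
pose d : chmap (dsum X Y) Z := chmap_comp f prl - chmap_comp p prr.
have dE n u : d n u = f n (prl n u) - p n (prr n u) by rewrite /d !chE.
clearbody d.
have [P [m [im dm exm]]] := kernel_complex d.
have mfp n x : f n (prl n (m n x)) = p n (prr n (m n x)).
  by apply/eqP; rewrite -subr_eq0 -dE dm.
have univ W (a : chmap W X) (b : chmap W Y) : chmap_comp f a = chmap_comp p b ->
    exists u : chmap W P, chmap_comp m u = chmap_comp dinl a + chmap_comp dinr b.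
  move=> ab.
  have H n w : exists x, m n x = dinl n (a n w) + dinr n (b n w).
    by apply: exm; rewrite dE !dsK -!chmap_compE ab subrr.
  have mV n w : m n ((m n)^-1%VF (dinl n (a n w) + dinr n (b n w))) =
      dinl n (a n w) + dinr n (b n w).
    by have [x <-] := H n w; rewrite injK.
  have [i0 j0 x|u uE] := @chmap_intro k W P
      (fun n => (m n)^-1 \o ((dinl n \o a n) + (dinr n \o b n)))%VF.
    apply: (injP im); rewrite !comp_lfunE !add_lfunE !comp_lfunE [RHS]chmapE !mV.
    by rewrite homD !chmapE.
  exists u; apply: chmap_ext => n w.
  by rewrite !chE uE comp_lfunE add_lfunE !comp_lfunE mV.
pose q := chmap_comp prl m; pose g := chmap_comp prr m.
have [|i' mi'] := univ K 0 i; first by apply: chmap_ext => n x; rewrite !chE pi linear0.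
have i'E n x : m n (i' n x) = dinr n (i n x).
  by have := chmap_eq x mi'; rewrite !chE linear0 add0r.
exists P, q, g, i'; split.
- apply/short_exactP; split=> [n x x0|n x|n x|n x].
  + by apply: (ii n); have := congr1 (prr n) (i'E n x); rewrite x0 dsK !linear0 => <-.
  + have [y yE] := sp n (f n x).
    have [|z zE] := exm n (dinl n x + dinr n y).
      by rewrite dE !dsK yE subrr.
    by exists z; rewrite /q chE zE dsK.
  + by rewrite /q chE i'E dsK.
  + rewrite /q chE => x0; have [|y yE] := ex n (prr n (m n x)).
      by rewrite -mfp x0 linear0.
    exists y; apply: (injP im).
    by rewrite i'E yE [in RHS](dsum_decomp (m n x)) x0 linear0 add0r.
- by apply: chmap_ext => n x; rewrite /g !chE i'E dsK.
- by apply: chmap_ext => n x; rewrite /q /g !chE mfp.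
- move=> W a b /univ[u uE]; exists u.
  have mu n w : m n (u n w) = dinl n (a n w) + dinr n (b n w).
    by rewrite -chmap_compE uE !chE.
  by split; apply: chmap_ext => n w; rewrite /q /g !chE mu dsK.
Qed.

(** [P] is the cokernel of [(f, - i)]. *)
Lemma pushout_complex X Y Z Q (f : chmap Z X) (i : chmap Z Y) (p : chmap Y Q) :
  short_exact i p ->
  exists P (q : chmap X P) (g : chmap Y P) (p' : chmap P Q),
  [/\ short_exact q p', chmap_comp p' g = p, chmap_comp q f = chmap_comp g i &
    forall W (a : chmap X W) (b : chmap Y W),
      chmap_comp a f = chmap_comp b i ->
      exists u : chmap P W, chmap_comp u q = a /\ chmap_comp u g = b].
Proof.
move=> /short_exactP[ii sp pi ex].
pose d : chmap Z (dsum X Y) := chmap_comp dinl f - chmap_comp dinr i.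
have dE n z : d n z = dinl n (f n z) - dinr n (i n z) by rewrite /d !chE.
clearbody d.
have [P [m [sm md exm]]] := cokernel_complex d.
have mfi n z : m n (dinl n (f n z)) = m n (dinr n (i n z)).
  by apply/eqP; rewrite -subr_eq0 -homB -dE md.
have di : inj d.
  move=> n z; rewrite dE => /(congr1 (prr n)); rewrite homB !dsK sub0r linear0.
  by move/eqP; rewrite oppr_eq0 => /eqP/ii.
have sd : short_exact d m by apply/short_exactP.
have univ W (a : chmap X W) (b : chmap Y W) : chmap_comp a f = chmap_comp b i ->
    exists u : chmap P W, chmap_comp u m = chmap_comp a prl + chmap_comp b prr.
  move=> ab; apply: (cokernel_factor sd); apply: chmap_ext => n z.
  by rewrite !chE dE !homB !dsK !linear0 addr0 add0r -!chmap_compE ab subrr.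
pose q := chmap_comp m dinl; pose g := chmap_comp m dinr.
have [|p' p'm] := univ Q 0 p; first by apply: chmap_ext => n z; rewrite !chE pi.
have p'E n u : p' n (m n u) = p n (prr n u).
  by have := chmap_eq u p'm; rewrite !chE add0r.
exists P, q, g, p'; split.
- apply/short_exactP; split=> [n x|n w|n x|n v].
  + rewrite /q chE => /exm[z]; rewrite dE => zE.
    have z0 : z = 0.
      apply: (ii n); have := congr1 (prr n) zE; rewrite homB !dsK sub0r.
      by move/eqP; rewrite oppr_eq0 => /eqP.
    by have := congr1 (prl n) zE; rewrite homB !dsK z0 !linear0 addr0.
  + by have [y <-] := sp n w; exists (m n (dinr n y)); rewrite p'E dsK.
  + by rewrite /q chE p'E dsK linear0.
  + have [u <-] := sm n v; rewrite p'E => /ex[z zE].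
    exists (prl n u + f n z); rewrite /q chE !homD mfi zE -homD.
    by rewrite -dsum_decomp.
- by apply: chmap_ext => n y; rewrite /g !chE p'E dsK.
- by apply: chmap_ext => n z; rewrite /q /g !chE mfi.
- move=> W a b /univ[u uE]; exists u.
  have um n w : u n (m n w) = a n (prl n w) + b n (prr n w).
    by rewrite -chmap_compE uE !chE.
  by split; apply: chmap_ext => n w; rewrite /q /g !chE um !dsK linear0 ?addr0 ?add0r.
Qed.

Lemma short_exact_iso X Y Z X' Y' Z' (i : chmap X Y) (p : chmap Y Z)
    (i' : chmap X' Y') (p' : chmap Y' Z') a a' b b' c c' :
  chmap_comp a' a = chmap_id X -> chmap_comp a a' = chmap_id X' ->
  chmap_comp b' b = chmap_id Y -> chmap_comp b b' = chmap_id Y' ->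
  chmap_comp c' c = chmap_id Z -> chmap_comp c c' = chmap_id Z' ->
  chmap_comp b i = chmap_comp i' a -> chmap_comp c p = chmap_comp p' b ->
  short_exact i p -> short_exact i' p'.
Proof.
move=> a'a aa' b'b bb' c'c cc' bi cp /short_exactP[ii sp pi ex].
have aa'_ n x : a n (a' n x) = x by rewrite -chmap_compE aa' chE.
have bb'_ n x : b n (b' n x) = x by rewrite -chmap_compE bb' chE.
have cc'_ n x : c n (c' n x) = x by rewrite -chmap_compE cc' chE.
have b'b_ n x : b' n (b n x) = x by rewrite -chmap_compE b'b chE.
have c'c_ n x : c' n (c n x) = x by rewrite -chmap_compE c'c chE.
have bi_ n x : i' n (a n x) = b n (i n x) by rewrite -!chmap_compE bi.
have cp_ n x : p' n (b n x) = c n (p n x) by rewrite -!chmap_compE cp.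
apply/short_exactP; split=> [n x|n z|n x|n y].
- rewrite -(aa'_ n x) bi_ => /(congr1 (b' n)); rewrite b'b_ linear0 => /ii->.
  exact: linear0.
- by have [y yE] := sp n (c' n z); exists (b n y); rewrite cp_ yE cc'_.
- by rewrite -(aa'_ n x) bi_ cp_ pi linear0.
- rewrite -(bb'_ n y) cp_ => /(congr1 (c' n)); rewrite c'c_ linear0.
  by move=> /ex[x xE]; exists (a n x); rewrite bi_ xE.
Qed.

Lemma biproduct_short_exact X Y B (iX : chmap X B) (iY : chmap Y B)
    (pX : chmap B X) (pY : chmap B Y) :
  chmap_comp pX iX = chmap_id X -> chmap_comp pY iY = chmap_id Y ->
  chmap_comp pY iX = 0 ->
  chmap_comp iX pX + chmap_comp iY pY = chmap_id B -> short_exact iX pY.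
Proof.
move=> pXi pYi pYiX sumE; apply/short_exactP; split=> [n x|n y|n x|n u u0].
- by move/(congr1 (pX n)); rewrite -chmap_compE pXi chE linear0.
- by exists (iY n y); rewrite -chmap_compE pYi chE.
- by rewrite -chmap_compE pYiX chE.
- have := chmap_eq u sumE; rewrite !chE u0 linear0 addr0 => <-.
  by exists (pX n u).
Qed.

End Squares.

(** * The Frobenius exact structure *)

Section EvenCategory.
Variable k : fieldType.
Local Notation A := (evenCh k).
Local Notation conf := (@evenCh_conf k).
Implicit Types X Y Z W : A.

Definition even_obj (X : cochain k) (eX : ~~ odd (betti X)) : A :=
  exist (fun X : Chb k => even_betti X) X eX.

Lemma even_sub (X Y Z : cochain k) (i : chmap X Y) (p : chmap Y Z) :
  short_exact i p -> ~~ odd (betti Y) -> ~~ odd (betti Z) -> ~~ odd (betti X).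
Proof. by move/odd_short_exact->; case: (odd _); case: (odd _). Qed.

Lemma even_ext (X Y Z : cochain k) (i : chmap X Y) (p : chmap Y Z) :
  short_exact i p -> ~~ odd (betti X) -> ~~ odd (betti Z) -> ~~ odd (betti Y).
Proof. by move/odd_short_exact->; case: (odd _); case: (odd _). Qed.

Lemma even_quo (X Y Z : cochain k) (i : chmap X Y) (p : chmap Y Z) :
  short_exact i p -> ~~ odd (betti X) -> ~~ odd (betti Y) -> ~~ odd (betti Z).
Proof. by move/odd_short_exact->; case: (odd _); case: (odd _). Qed.

Lemma conf_kernel X Y Z (i : hom A X Y) (p : hom A Y Z) :
  conf i p -> is_kernel i p.
Proof.
move=> se; have /short_exactP[ii _ pi _] := se.
split=> [|W h ph]; first by apply: chmap_ext => n x; rewrite !chE pi.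
have [u uE] := kernel_factor se ph; exists u; split=> // v vE.
by apply: (inj_cancel ii); rewrite uE -vE.
Qed.

Lemma conf_cokernel X Y Z (i : hom A X Y) (p : hom A Y Z) :
  conf i p -> is_cokernel i p.
Proof.
move=> se; have /short_exactP[_ sp pi _] := se.
split=> [|W h hi]; first by apply: chmap_ext => n x; rewrite !chE pi.
have [u uE] := cokernel_factor se hi; exists u; split=> // v vE.
by apply: (surj_cancel sp); rewrite uE -vE.
Qed.

(** The kernel of a surjection of even complexes is even. *)
Lemma deflationP Y Z (p : hom A Y Z) :
  deflation conf p <-> surj (p : chmap (sval Y) (sval Z)).
Proof.
split=> [[X [i /short_exactP[]]] //|sp].
have [K [i [ii pi ex]]] := kernel_complex (p : chmap (sval Y) (sval Z)).
have se : short_exact i p by apply/short_exactP.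
by exists (even_obj (even_sub se (svalP Y) (svalP Z))), i.
Qed.

Lemma inflationP X Y (i : hom A X Y) :
  inflation conf i <-> inj (i : chmap (sval X) (sval Y)).
Proof.
split=> [[Z [p /short_exactP[]]] //|ii].
have [Q [p [sp pi ex]]] := cokernel_complex (i : chmap (sval X) (sval Y)).
have se : short_exact i p by apply/short_exactP.
by exists (even_obj (even_quo se (svalP X) (svalP Y))), p.
Qed.

Lemma conf_pullback X Y Z K (f : hom A X Z) (i : hom A K Y) (p : hom A Y Z) :
  conf i p -> exists (P : A) (q : hom A P X) (g : hom A P Y) (i' : hom A K P),
  [/\ conf i' q, is_pullback q g f p & g \oc i' = i].
Proof.
move=> se; have [P [q [g [i' [se' gi' fq univ]]]]] :=
  pullback_complex (f : chmap (sval X) (sval Z)) se.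
exists (even_obj (even_ext se' (svalP K) (svalP X))), q, g, i'; split=> //.
split=> // W a b ab; have [u [qu gu]] := univ _ a b ab.
exists u; split=> // v [qv gv]; apply: chmap_ext => n x.
(* [q] kills the difference of two solutions, which thus comes from [K];
   [g] kills it too and is injective on [K] *)
apply/eqP; rewrite -subr_eq0; apply/eqP.
have /short_exactP[ii' _ _ ex'] := se'; have /short_exactP[ii _ _ _] := se.
have [|y yE] := ex' n (u n x - v n x).
  by rewrite homB -!chmap_compE qu [chmap_comp q v]qv subrr.
rewrite -yE; suff -> : y = 0 by rewrite linear0.
apply: (ii n); rewrite -gi' chE yE homB -!chmap_compE gu.
by rewrite [chmap_comp g v]gv subrr.
Qed.

Lemma conf_pushout X Y Z Q (f : hom A Z X) (i : hom A Z Y) (p : hom A Y Q) :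
  conf i p -> exists (P : A) (q : hom A X P) (g : hom A Y P) (p' : hom A P Q),
  [/\ conf q p', is_pushout f i q g & p' \oc g = p].
Proof.
move=> se; have [P [q [g [p' [se' p'g qf univ]]]]] :=
  pushout_complex (f : chmap (sval Z) (sval X)) se.
exists (even_obj (even_ext se' (svalP X) (svalP Q))), q, g, p'; split=> //.
split=> // W a b ab; have [u [uq ug]] := univ _ a b ab.
exists u; split=> // v [vq vg]; apply: chmap_ext => n x.
have /short_exactP[_ _ _ ex'] := se'; have /short_exactP[_ sp _ _] := se.
have [y yE] := sp n (p' n x).
have [|z zE] := ex' n (x - g n y).
  by rewrite homB -chmap_compE p'g yE subrr.
rewrite -(subrK (g n y) x) -zE !homD -!chmap_compE uq ug.
by rewrite [chmap_comp v q]vq [chmap_comp v g]vg.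
Qed.

Lemma even_dsum (X Y : cochain k) : odd (betti X) = odd (betti Y) ->
  ~~ odd (betti (dsum X Y)).
Proof. by rewrite odd_dsum => ->; rewrite addbb. Qed.

Lemma evenCh_additive : is_additive A.
Proof.
have z0 (V := stalk 0 'rV[k]_0) : ~~ odd (betti V).
  by rewrite odd_stalk dimvf dim_matrix.
split.
  exists (even_obj z0); apply: chmap_ext => n x.
  have d0 : \dim {: stalk 0 'rV[k]_0 n} = 0%N.
    by rewrite /= /stalk_term; case: ifP => _; rewrite dimvf dim_matrix.
  by rewrite !chE; apply: dim0_eq0.
move=> X Y.
exists (even_obj (even_ext (dsum_short_exact (sval X) (sval Y)) (svalP X) (svalP Y))).
exists dinl, dinr, prl, prr; split; apply: chmap_ext => n x; rewrite !chE ?dsK //.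
by rewrite -dsum_decomp.
Qed.

(** Closure under composition and the obscure axioms become statements about
    surjective and injective maps. *)
Lemma evenCh_exact : is_exact conf.
Proof.
split.
- exact: evenCh_additive.
- move=> X Y Z X' Y' Z' i p i' p' a b c [a' [a'a aa']] [b' [b'b bb']] [c' [c'c cc']] bi cp.
  exact: short_exact_iso a'a aa' b'b bb' c'c cc' bi cp.
- by move=> X Y B iX iY pX pY [e1 e2 e3 _ e5]; apply: biproduct_short_exact e1 e2 e3 e5.
- by move=> X Y Z i p se; split; [apply: conf_kernel | apply: conf_cokernel].
- move=> X Y Z p q /deflationP sp /deflationP sq; apply/deflationP => n z.
  by have [y <-] := sq n z; have [x <-] := sp n y; exists x; rewrite chE.
- move=> X Y Z i j /inflationP ii /inflationP ij; apply/inflationP => n x.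
  by rewrite chE => /ij/ii.
- move=> X Y Z f p [K [i se]]; have [P [q [g [i' [se' pb _]]]]] := conf_pullback f se.
  by exists P, q, g; split=> //; exists K, i'.
- move=> X Y Z f i [Q [p se]]; have [P [q [g [p' [se' po _]]]]] := conf_pushout f se.
  by exists P, q, g; split=> //; exists Q, p'.
- move=> X Y Z q p _ /deflationP spq; apply/deflationP => n z.
  by have [x <-] := spq n z; exists (q n x); rewrite chE.
- move=> X Y Z i j _ /inflationP iji; apply/inflationP => n x ix0.
  by apply: (iji n); rewrite chE ix0 linear0.
Qed.

Lemma acyclic_even (X : cochain k) : acyclic X -> ~~ odd (betti X).
Proof. by move/acyclic_betti->. Qed.

Lemma acyclic_projective X : acyclic (sval X) -> projective conf X.
Proof.
move=> aX Y Z p f [K [i se]].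
have [g pg] := orth_lift (f : chmap (sval X) (sval Z)) se (orth_acyclicl _ aX).
by exists g.
Qed.

Lemma acyclic_injective X : acyclic (sval X) -> injective_obj conf X.
Proof.
move=> aX Y Z i f [Q [p se]].
have [g gi] := orth_extend (f : chmap (sval Y) (sval X)) se (orth_acyclicr _ aX).
by exists g.
Qed.

(** A projective object is a retract of its disk cover. *)
Lemma projective_acyclic X : projective conf X -> acyclic (sval X).
Proof.
move=> pX n; have [P [p [aP sp]]] := disk_cover (sval X).
have [|g pg] := pX (even_obj (acyclic_even aP)) X p (idm X).
  exact/deflationP.
exact: (retract_acyclic (f := g) (g := p)).
Qed.

Lemma injective_acyclic X : injective_obj conf X -> acyclic (sval X).
Proof.
move=> iX n; have [I [i [aI ii]]] := disk_hull (sval X).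
have [|g gi] := iX X (even_obj (acyclic_even aI)) i (idm X).
  exact/inflationP.
exact: (retract_acyclic (f := i) (g := g)).
Qed.

Lemma evenCh_frobenius : is_frobenius conf.
Proof.
split; first exact: evenCh_exact.
- move=> X; have [P [p [aP sp]]] := disk_cover (sval X).
  exists (even_obj (acyclic_even aP)), p.
  by split; [apply: acyclic_projective | apply/deflationP].
- move=> X; have [I [i [aI ii]]] := disk_hull (sval X).
  exists (even_obj (acyclic_even aI)), i.
  by split; [apply: acyclic_injective | apply/inflationP].
- move=> X; split=> [/projective_acyclic|/injective_acyclic].
    exact: acyclic_injective.
  exact: acyclic_projective.
Qed.

Lemma evenCh_weakly_idempotent : weakly_idempotent_complete A.
Proof.
move=> X Y s [r rs]; have : inj (s : chmap (sval X) (sval Y)).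
  by move=> n x sx0; have := chmap_eq x rs; rewrite !chE sx0 linear0.
by move/inflationP => [Z [c se]]; exists Z, c; apply: conf_cokernel se.
Qed.

Lemma quasi_iso_iso (X Y : cochain k) (f : chmap X Y) (g : chmap Y X) :
  chmap_comp g f = chmap_id X -> chmap_comp f g = chmap_id Y -> quasi_iso f.
Proof.
move=> gf fg n; have gfE z : g n (f n z) = z by rewrite -chmap_compE gf chE.
have fgE z : f n (g n z) = z by rewrite -chmap_compE fg chE.
split=> [z _ /(chmap_coboundary g)|w wc]; first by rewrite gfE.
exists (g n w); first exact: chmap_cocycle.
by rewrite fgE subrr; exists 0; rewrite linear0.
Qed.

Lemma odd_stalk1 r : odd (betti (stalk r k^o)).
Proof. by rewrite odd_stalk dimvf /dim. Qed.

(** The projection of [S + S] onto one copy of an object [S] of odd Betti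
    number could only split through a complex isomorphic to [S]. *)
Lemma evenCh_not_idempotent : ~ idempotent_complete A.
Proof.
pose S := stalk 0 k^o; have oS : odd (betti S) := odd_stalk1 0.
pose X := even_obj (even_dsum (erefl (odd (betti S)))).
pose e : hom A X X := (chmap_comp dinl prl : chmap (dsum S S) (dsum S S)).
move=> /(_ X e)[|Y [r [s [sr rs]]]].
  by apply: chmap_ext => n x; rewrite !chE dsK.
pose f : chmap (sval Y) S := chmap_comp prl s.
pose g : chmap S (sval Y) := chmap_comp r dinl.
have srE n x : s n (r n x) = dinl n (prl n x).
  by have := chmap_eq x sr; rewrite !chE.
have rsE n x : r n (s n x) = x by have := chmap_eq x rs; rewrite !chE.
have : betti (sval Y) = betti S.
  apply/quasi_iso_betti/(@quasi_iso_iso _ _ f g); apply: chmap_ext => n x.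
    by rewrite !chE -[RHS]rsE -(rsE n x) srE dsK -srE !rsE.
  by rewrite !chE srE !dsK.
by move=> bY; have := svalP Y; rewrite /even_betti bY oS.
Qed.

End EvenCategory.

(** * Finite-dimensionality of the spaces of chain maps *)

Section HomFinite.
Import VectorInternalTheory.
Variable k : fieldType.

(** A largest row-free family of vectors in the range of [phi] spans it, and
    coordinates along that family give the isomorphism. *)
Lemma finite_of_injection (L : lmodType k) m (phi : L -> 'rV[k]_m) :
  linear phi -> injective phi ->
  exists (n : nat) (psi : L -> 'rV[k]_n), linear psi /\ bijective psi.
Proof.
move=> lphi iphi.
pose Phi : {linear L -> 'rV[k]_m} :=
  HB.pack phi (GRing.isLinear.Build k L 'rV[k]_m _ phi lphi).
have PhiE l : Phi l = phi l by [].
pose P n := `[< exists M : 'M[k]_(n, m), row_free M /\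
   forall i, exists l, phi l = row i M >].
have P0 : exists n, P n.
  exists 0%N; apply/asboolP; exists 0; split; last by case.
  by rewrite /row_free mxrank0.
have Pm n : P n -> (n <= m)%N.
  by move=> /asboolP[M [fM _]]; rewrite -(eqP fM) rank_leq_col.
case: (ex_maxnP P0 Pm) => n /asboolP[M [fM lM]] nmax.
have [ls lsE] := choice lM.
have span l : (phi l <= M)%MS.
  apply: contraT => lnM; have : P n.+1.
    apply/asboolP; rewrite -[n.+1]addn1; exists (col_mx M (phi l)); split.
      have lt : (\rank M < \rank (col_mx M (phi l)))%N.
        by rewrite -addsmxE; apply: rank_ltmx; rewrite /ltmx addsmxSl /= addsmx_sub submx_refl.
      rewrite /row_free eqn_leq rank_leq_row /=; apply: leq_trans lt.
      by rewrite (eqP fM) addn1.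
    move=> i; case: (splitP i) => j ij.
      exists (ls j); rewrite lsE; have -> : i = lshift 1 j by apply: val_inj.
      by apply/rowP => c; rewrite mxE [RHS]mxE col_mxEu.
    exists l; have -> : i = rshift n j by apply: val_inj.
    by apply/rowP => c; rewrite mxE col_mxEd ord1.
  by move/nmax; rewrite ltnn.
exists n, (fun l => phi l *m pinvmx M); split.
  by move=> a x y; rewrite lphi mulmxDl scalemxAl.
exists (fun c : 'rV[k]_n => \sum_i c 0 i *: ls i) => [l|c].
  apply: iphi; rewrite -PhiE linear_sum /=.
  rewrite -[in RHS](mulmxKpV (span l)) [RHS]mulmx_sum_row.
  by apply: eq_bigr => i _; rewrite -PhiE linearZ /= lsE.
rewrite -PhiE linear_sum /= (eq_bigr (fun i => c 0 i *: row i M)).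
  by rewrite -mulmx_sum_row mulmxKp.
by move=> i _; rewrite -PhiE linearZ /= lsE.
Qed.

Lemma evenCh_hom_finite : hom_finite (evenCh k).
Proof.
move=> [X eX] [Y eY]; rewrite /hom /=.
have [a [N h]] := common_range X X X.
have H M : exists m (phi : chmap X Y -> 'rV[k]_m), linear phi /\
    forall f, phi f = 0 -> forall i, (i < M)%N -> f (a + i%:Z) = 0.
  elim: M => [|M [m [phi [lphi phi0]]]].
    by exists 0%N, (fun => 0); split=> // b f g; rewrite scaler0 addr0.
  exists _, (fun f => row_mx (phi f) (v2r (f (a + M%:Z)))); split.
    move=> b f g; rewrite lphi [X in row_mx _ X](_ : _ = b *: v2r (f (a + M%:Z)) + v2r (g (a + M%:Z))).
      by rewrite scale_row_mx add_row_mx.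
    by rewrite -linearZ -linearD.
  move=> f f0 i; rewrite ltnS leq_eqVlt => /predU1P[->|]; last first.
    by apply: phi0; have := congr1 lsubmx f0; rewrite row_mxKl linear0.
  have := congr1 rsubmx f0; rewrite row_mxKr linear0 => v0.
  by apply: v2r_inj; rewrite v0 linear0.
have [m [phi [lphi phi0]]] := H N.
apply: (finite_of_injection lphi) => f g fg.
apply/eqP; rewrite -subr_eq0; apply/eqP.
have {}fg : phi (f - g) = 0.
  by rewrite addrC -scaleN1r lphi fg scaleN1r addNr.
apply: chmapP => n; case: (ltrP n a) => [na|an].
  by apply/lfunP => x; rewrite (dim0_eq0 x) ?linear0 //; case: (h n); auto.
case: (lerP (a + N%:Z) n) => [nN|Nn].
  by apply/lfunP => x; rewrite (dim0_eq0 x) ?linear0 //; case: (h n); auto.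
have -> : n = a + (absz (n - a))%:Z by lia.
by apply: phi0 => //; lia.
Qed.

End HomFinite.

(** * The cotorsion pairs *)

Section GeneratedIdeal.
Variables (k : fieldType) (A : lincat k).
Implicit Types X Y Z : A.

Lemma comp_addl X Y Z (g g' : hom A Y Z) (f : hom A X Y) :
  (g + g') \oc f = g \oc f + g' \oc f.
Proof. by have := comp_linl 1 g g' f; rewrite !scale1r. Qed.

Lemma comp_addr X Y Z (g : hom A Y Z) (f f' : hom A X Y) :
  g \oc (f + f') = g \oc f + g \oc f'.
Proof. by have := comp_linr 1 g f f'; rewrite !scale1r. Qed.

Lemma comp_0r X Y Z (g : hom A Y Z) : g \oc (0 : hom A X Y) = 0.
Proof. by have := comp_linr (-1) g (0 : hom A X Y) 0; rewrite !scaleN1r !addNr. Qed.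

Lemma ideal_gen_ideal (G : obj_class A) (O : A) : G O ->
  (forall X Y, G X -> G Y ->
     exists B (iX : hom A X B) (iY : hom A Y B) (pX : hom A B X) (pY : hom A B Y),
       is_biproduct iX iY pX pY /\ G B) ->
  is_ideal (ideal_gen G).
Proof.
move=> GO Gsum; split.
- by move=> X Y; exists O, 0, 0; split=> //; apply: comp_0r.
- move=> X Y f g [W [a [b [GW <-]]]] [V [c [d [GV <-]]]].
  have [B [iX [iY [pX [pY [[e1 e2 e3 e4 _] GB]]]]]] := Gsum W V GW GV.
  exists B, (iX \oc a + iY \oc c), (b \oc pX + d \oc pY); split=> //.
  rewrite comp_addr !comp_addl -!comp_assoc.
  rewrite !(comp_assoc pX) !(comp_assoc pY) e1 e2 e3 e4 !comp_idl.
  have comp_0l Z (h : hom A X Z) : (0 : hom A Z _) \oc h = 0 :> hom A X W.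
    by have := comp_linl (-1) (0 : hom A Z W) 0 h; rewrite !scaleN1r !addNr.
  have comp_0l' Z (h : hom A X Z) : (0 : hom A Z _) \oc h = 0 :> hom A X V.
    by have := comp_linl (-1) (0 : hom A Z V) 0 h; rewrite !scaleN1r !addNr.
  by rewrite comp_0l comp_0l' !comp_0r addr0 add0r.
- move=> X Y Z g f [W [a [b [GW <-]]]]; exists W, a, (g \oc b); split=> //.
  by rewrite comp_assoc.
- move=> X Y Z g f [W [a [b [GW <-]]]]; exists W, (a \oc f), b; split=> //.
  by rewrite comp_assoc.
Qed.

Lemma in_ideal_gen (G : obj_class A) X : G X -> ideal_gen G (idm X).
Proof. by move=> GX; exists X, (idm X), (idm X); split=> //; apply: comp_idl. Qed.

Lemma object_ideal_gen (G : obj_class A) : is_ideal (ideal_gen G) ->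
  obj_class_eq (Ob (ideal_gen G)) G -> is_object_ideal (ideal_gen G).
Proof.
move=> iG oG; split=> // X Y f.
by split=> -[W [a [b [GW ba]]]]; exists W, a, b; split=> //; apply/oG.
Qed.

Lemma pullback_id X Z (p : hom A X Z) : is_pullback p (idm X) (idm Z) p.
Proof.
split=> [|W a b ab]; first by rewrite comp_idl comp_idr.
exists b; split=> [|u [_ <-]]; rewrite comp_idl //.
by rewrite -ab comp_idl.
Qed.

Lemma pushout_id Z Y (i : hom A Z Y) : is_pushout (idm Z) i i (idm Y).
Proof.
split=> [|W a b ab]; first by rewrite comp_idl comp_idr.
exists b; split=> [|u [_ <-]]; rewrite comp_idr //.
by rewrite -ab comp_idr.
Qed.

End GeneratedIdeal.

Section Cotorsion.
Variable k : fieldType.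
Local Notation A := (evenCh k).
Local Notation conf := (@evenCh_conf k).
Local Notation F := (@classF k).
Local Notation C := (@classC k).
Implicit Types X Y Z W : A.

Lemma classFP X : F X <-> coh_le0 (sval X).
Proof. by split=> h n n1; apply/acyclicP/h. Qed.

Lemma classCP X : C X <-> coh_ge2 (sval X).
Proof. by split=> h n n1; apply/acyclicP/h. Qed.

(** Since [f] factors through [W] in [F] and [g] through [V] in [C], the map
    [g phi f] that represents the resulting extension is sandwiched from a
    degree-one map [W -> V], which is null-homotopic. *)
Lemma Ext1_map_zero_FC X0 X1 Y0 Y1 (f : hom A X0 X1) (g : hom A Y0 Y1) :
  ideal_gen F f -> ideal_gen C g -> Ext1_map_zero conf f g.
Proof.
move=> [W [a [b [/classFP FW baf]]]] [V [a' [b' [/classCP CV bag]]]] xi zeta.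
move=> [xi' [[h [[fp _] hi]] [h' [[ig _] ph']]]].
have [s [phi phiE]] := ext_cocycle_exists (ext_conf xi).
have [s'' zE] := ext_cocycle_map (ext_conf xi) (ext_conf xi') phiE
  (esym fp) hi ig ph'.
apply: (null_lift (f := chmap_id (sval X0)) (ext_conf zeta) zE).
have := sandwich_cocycle a' b (ext_cocycleP (ext_conf xi) phiE).
move=> /(orth_null (orth_le0_ge2 FW CV))/(sandwich_null b' a); apply: eq_null => i j x.
rewrite !sandwichE !chE -[f in RHS]baf -[g in RHS]bag.
by rewrite [in RHS](chmap_compE b a) [in RHS](chmap_compE b' a').
Qed.

Lemma biproduct_even X Y : exists eB : ~~ odd (betti (dsum (sval X) (sval Y))),
  @is_biproduct k A X Y (even_obj eB) dinl dinr prl prr.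
Proof.
exists (even_ext (dsum_short_exact (sval X) (sval Y)) (svalP X) (svalP Y)).
split; apply: chmap_ext => n x; rewrite !chE ?dsK //.
by rewrite -dsum_decomp.
Qed.

Lemma acyclic_object : exists X : A, acyclic (sval X).
Proof.
have [P [p [aP _]]] := disk_cover (stalk 0 k^o).
by exists (even_obj (acyclic_even aP)).
Qed.

Lemma idealF : is_ideal (ideal_gen F).
Proof.
have [O aO] := acyclic_object; apply: (ideal_gen_ideal (O := O)).
  by apply/classFP => n _; apply: aO.
move=> X Y /classFP FX /classFP FY; have [eB bi] := biproduct_even X Y.
exists (even_obj eB), dinl, dinr, prl, prr; split=> //.
by apply/classFP => n n1; apply: dsum_acyclic; [apply: FX | apply: FY].
Qed.

Lemma idealC : is_ideal (ideal_gen C).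
Proof.
have [O aO] := acyclic_object; apply: (ideal_gen_ideal (O := O)).
  by apply/classCP => n _; apply: aO.
move=> X Y /classCP CX /classCP CY; have [eB bi] := biproduct_even X Y.
exists (even_obj eB), dinl, dinr, prl, prr; split=> //.
by apply/classCP => n n1; apply: dsum_acyclic; [apply: CX | apply: CY].
Qed.

Lemma Ob_F : obj_class_eq (Ob (ideal_gen F)) F.
Proof.
move=> X; split=> [[W [a [b [/classFP FW ba]]]]|]; last exact: in_ideal_gen.
by apply/classFP => n n1; apply: (retract_acyclic (f := a) (g := b)) => //; apply: FW.
Qed.

Lemma Ob_C : obj_class_eq (Ob (ideal_gen C)) C.
Proof.
move=> X; split=> [[W [a [b [/classCP CW ba]]]]|]; last exact: in_ideal_gen.
by apply/classCP => n n1; apply: (retract_acyclic (f := a) (g := b)) => //; apply: CW.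
Qed.

(** The approximation [K -> L -> X] taken in all bounded complexes may have [K]
    and [L] of odd Betti number.  A copy of [S^2(k)] added to both restores
    parity and keeps the kernel in [C]; the new middle term need not lie in
    [F], but the deflation still ignores the copy of [S^2(k)], so it factors
    through [L + S^0(k)], which does. *)
Lemma even_precover X : exists (B E : A) (b : hom A B E) (p : hom A E X),
  [/\ conf b p, C B & ideal_gen F p].
Proof.
have [K [L [i [p [se hL lK]]]]] := precover_exists (sval X).
pose T r := stalk r 'rV[k]_(odd (betti L)).
have oT r : odd (betti L) = odd (betti (T r)).
  by rewrite odd_stalk dimvf dim_matrix; case: (odd _).
have se' := short_exact_addl (T 2) se.
have eE r : ~~ odd (betti (dsum L (T r))) := even_dsum (oT r).
exists (even_obj (even_sub se' (eE 2) (svalP X))), (even_obj (eE 2)), (chmap_comp dinl (chmap_comp i prl) + chmap_comp dinr prr :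
    chmap (dsum K (T 2)) (dsum L (T 2))), (chmap_comp p prl).
split; first exact: se'.
  apply/classCP => n n1; apply: dsum_acyclic; first exact: lK.
  by apply: stalk_acyclic; lia.
exists (even_obj (eE 0)), (chmap_comp dinl prl), (chmap_comp p prl); split.
  apply/classFP => n n1; apply: dsum_acyclic; first exact: hL.
  by apply: stalk_acyclic; lia.
by apply: chmap_ext => n u; rewrite !chE dsK.
Qed.

Lemma even_preenvelope X : exists (D G : A) (j : hom A X D) (q : hom A D G),
  [/\ conf j q, ideal_gen C j & F G].
Proof.
have [D [G [j [q [se lD hG]]]]] := preenvelope_exists (sval X).
pose T r := stalk r 'rV[k]_(odd (betti D)).
have oT r : odd (betti D) = odd (betti (T r)).
  by rewrite odd_stalk dimvf dim_matrix; case: (odd _).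
have se' := short_exact_addr (T 0) se.
have eE r : ~~ odd (betti (dsum D (T r))) := even_dsum (oT r).
exists (even_obj (eE 0)), (even_obj (even_quo se' (svalP X) (eE 0))), (chmap_comp dinl j),
  (chmap_comp dinl (chmap_comp q prl) + chmap_comp dinr prr :
    chmap (dsum D (T 0)) (dsum G (T 0))).
split; first exact: se'.
  exists (even_obj (eE 2)), (chmap_comp dinl j), (chmap_comp dinl prl); split.
    apply/classCP => n n1; apply: dsum_acyclic; first exact: lD.
    by apply: stalk_acyclic; lia.
  by apply: chmap_ext => n u; rewrite !chE dsK.
apply/classFP => n n1; apply: dsum_acyclic; first exact: hG.
by apply: stalk_acyclic; lia.
Qed.

Lemma section_retraction X Y Z (i : hom A X Y) (p : hom A Y Z) (s : hom A Z Y) :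
  conf i p -> p \oc s = idm Z -> exists r : hom A Y X, r \oc i = idm X.
Proof.
move=> se ps; have /short_exactP[ii _ pi _] := se.
have [|r ir] := kernel_factor (h := (idm Y - s \oc p : hom A Y Y)) se.
  apply: chmap_ext => n y; have := chmap_eq (p n y) ps; rewrite !chE homB.
  by move=> ->; rewrite subrr.
exists r; apply: chmap_ext => n x; apply: (injP ii).
by have := chmap_eq (i n x) ir; rewrite !chE => ->; rewrite pi !linear0 addr0.
Qed.

(** If [f] is orthogonal to the ideal of [C], it pulls back the approximation
    of its target to a split extension; so it lifts to the middle term, and
    factors through the deflation, which is in the ideal of [F]. *)
Lemma lperp_C : mor_class_eq (ideal_gen F) (lperp conf (ideal_gen C)).
Proof.
move=> X0 X1 f; split=> [Ff Y0 Y1 g|fC]; first exact: Ext1_map_zero_FC.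
have [B [E [b [p [se CB Fp]]]]] := even_precover X1.
have [P [q [g [b' [se' pb gb]]]]] := conf_pullback f se.
have [|s qs] := fC B B (idm B) (in_ideal_gen CB)
    (Extension se) (Extension se').
  exists (Extension se'); split; first by exists g.
  by exists (idm P); split; [apply: pushout_id | apply: comp_idr].
have <- : p \oc (g \oc s) = f by rewrite comp_assoc -pb.1 -comp_assoc qs comp_idr.
by apply: (ideal_compr idealF).
Qed.

Lemma rperp_F : mor_class_eq (ideal_gen C) (rperp conf (ideal_gen F)).
Proof.
move=> Y0 Y1 g; split=> [Cg X0 X1 f Ff|gF]; first exact: Ext1_map_zero_FC.
have [D [G [j [q [se Cj FG]]]]] := even_preenvelope Y0.
have [P [j' [h [q' [se' po qh]]]]] := conf_pushout g se.
have [|s qs] := gF G G (idm G) (in_ideal_gen FG)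
    (Extension se) (Extension se').
  exists (Extension se); split; last by exists h.
  by exists (idm D); split; [apply: pullback_id | apply: comp_idl].
have [r rj] := section_retraction se' qs.
have <- : (r \oc h) \oc j = g by rewrite -comp_assoc -po.1 comp_assoc rj comp_idl.
by apply: (ideal_compl idealC).
Qed.

Lemma ideal_pair_FC : ideal_cotorsion_pair conf (ideal_gen F) (ideal_gen C).
Proof.
by split; [apply: idealF | apply: idealC | apply: lperp_C | apply: rperp_F].
Qed.

(** The kernels and cokernels of the approximations are objects of [C]
    and [F], so the approximations are special with an identity map in place of
    the morphism of the orthogonal ideal. *)
Lemma complete_FC :
  complete_ideal_cotorsion_pair conf (ideal_gen F) (ideal_gen C).
Proof.
split; first exact: ideal_pair_FC.
- move=> X; have [B [E [b [p [se CB Fp]]]]] := even_precover X.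
  exists E, p; split; first split=> // W f [V [a [c [FV <-]]]].
    have [u pu] : exists u : hom A V E, p \oc u = c := orth_lift (c : chmap (sval V) (sval X)) se
      (orth_le0_ge2 ((classFP V).1 FV) ((classCP B).1 CB)).
    by exists (u \oc a); rewrite comp_assoc pu.
  exists B, B, (Extension se), (idm B), b, se; split.
    by apply/rperp_F/in_ideal_gen.
  by exists (idm E); split; [apply: pushout_id | apply: comp_idr].
- move=> X; have [D [G [j [q [se Cj FG]]]]] := even_preenvelope X.
  exists D, j; split; first split=> // W f [V [a [c [CV <-]]]].
    have [u uj] : exists u : hom A D V, u \oc j = a := orth_extend (a : chmap (sval X) (sval V)) se
      (orth_le0_ge2 ((classFP G).1 FG) ((classCP V).1 CV)).
    by exists (c \oc u); rewrite -comp_assoc uj.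
  exists G, G, (Extension se), (idm G), q, se; split.
    by apply/lperp_C/in_ideal_gen.
  by exists (idm D); split; [apply: pullback_id | apply: comp_idl].
Qed.

Lemma Ext1_zero_FC X Y : F X -> C Y -> Ext1_zero conf X Y.
Proof.
move=> /classFP FX /classCP CY xi.
have [s ps] := orth_lift (chmap_id (sval X)) (ext_conf xi) (orth_le0_ge2 FX CY).
by exists s.
Qed.

Lemma cotorsion_FC : cotorsion_pair conf F C.
Proof.
split=> X; split=> [FX Y CY|XP].
- exact: Ext1_zero_FC.
- have [B [E [b [p [se CB Fp]]]]] := even_precover X.
  have [s ps] := XP B CB (Extension se).
  by apply/Ob_F; rewrite /Ob -ps; apply: (ideal_compr idealF).
- exact: Ext1_zero_FC.
- have [D [G [j [q [se Cj FG]]]]] := even_preenvelope X.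
  have [u uj] : exists u : hom A D X, u \oc j = idm X.
    by have [s qs] := XP G FG (Extension se); apply: section_retraction qs.
  by apply/Ob_C; rewrite /Ob -uj; apply: (ideal_compl idealC).
Qed.
End Cotorsion.

(** * The object without approximations *)

Section Obstruction.
Variable k : fieldType.
Local Notation A := (evenCh k).
Local Notation F := (@classF k).
Local Notation C := (@classC k).
Local Notation S r := (stalk r k^o).

Lemma objM_even : even_betti (objM k).
Proof. by apply: even_dsum; rewrite !odd_stalk1. Qed.

Lemma stalk_diff r (V : vectType k) i j (x : stalk r V i) : cdiff (stalk r V) i j x = 0.
Proof. exact: lfunE. Qed.

(** A special precover [K -> E -> M] would make the composite
    [E -> M -> S^0(k)] a quasi-isomorphism, as [H^n(K) = 0] for [n <= 1]. *)
Lemma no_special_precover :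
  ~ has_special_precover (@evenCh_conf k) F C (exist _ (objM k) objM_even).
Proof.
move=> [K [E [i [p [se /classFP FE /classCP CK]]]]].
have sep : short_exact (i : chmap (sval K) (sval E)) (p : chmap (sval E) (objM k)) := se.
have [ii sp pi ex] := (short_exactP _ _).1 sep.
suff : quasi_iso (chmap_comp prl p : chmap (sval E) (S 0)).
  by move=> /quasi_iso_betti bE; have := svalP E; rewrite /even_betti bE odd_stalk1.
move=> n; case: (lerP 1 n) => n1.
  split=> [z zc _|w wc]; first exact: FE.
  exists 0; first exact: linear0.
  by rewrite linear0 subr0; apply: stalk_acyclic => //; lia.
have M0 (u : objM k n) : prl n u = 0 -> u = 0.
  move=> u0; apply: dsum_eq0 => //; apply: dim0_eq0; apply: dim_stalk0; lia.
split=> [z zc|w wc].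
  rewrite chE => -[y]; rewrite stalk_diff => /esym/M0/ex[x xz].
  have xc : cocycle x by apply: (ii (n + 1)); rewrite chmapE xz.
  have [|y' y'E] := CK n _ x xc; first by lia.
  by rewrite -xz -y'E chmapE; apply: coboundary_diff.
have lc : cocycle (dinl n w : objM k n) by rewrite /cocycle -chmapE stalk_diff linear0.
have [|z zc zE] := short_exact_connecting sep _ lc; first by apply: CK; lia.
by exists z => //; rewrite chE zE dsK subrr; exists 0; rewrite linear0.
Qed.

(** Dually, [S^2(k) -> M -> E] would be a quasi-isomorphism, as [H^n(K) = 0] for
    [n >= 1]. *)
Lemma no_special_preenvelope :
  ~ has_special_preenvelope (@evenCh_conf k) F C (exist _ (objM k) objM_even).
Proof.
move=> [E [K [i [p [se /classCP CE /classFP FK]]]]].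
have sep : short_exact (i : chmap (objM k) (sval E)) (p : chmap (sval E) (sval K)) := se.
have [ii sp pi ex] := (short_exactP _ _).1 sep.
suff : quasi_iso (chmap_comp i dinr : chmap (S 2) (sval E)).
  by move=> /quasi_iso_betti bE; have := svalP E; rewrite /even_betti -bE odd_stalk1.
move=> n; case: (lerP n 1) => n1.
  split=> [z zc _|w wc].
    by apply: stalk_acyclic => //; lia.
  exists 0; first exact: linear0.
  by rewrite linear0 subr0; apply: CE.
have M0 (u : objM k n) : prr n u = 0 -> u = 0.
  by move=> u0; apply: dsum_eq0 => //; apply: dim0_eq0; apply: dim_stalk0; lia.
have dM m l (u : objM k m) : cdiff (objM k) m l u = 0.
  by rewrite /= dsum_diffE !stalk_diff.
split=> [z zc|w wc].
  rewrite chE => -[y yE].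
  (* [p y] is a cocycle, so after subtracting a coboundary [y] comes from [M],
     where the differential vanishes *)
  have [||e eE] := FK (n - 1) _ (p (n - 1) y); first by lia.
    apply: (cocycle_succ (n := n)); first by rewrite subrK.
    by rewrite -chmapE yE pi.
  have [e' e'E] := sp _ e.
  have [|u uE] := ex (n - 1) (y - cdiff (sval E) _ _ e').
    by rewrite homB chmapE e'E eE subrr.
  have iz : i n (dinr n z) = 0.
    have := chmapE i n u; rewrite dM linear0 uE homB diffK subr0.
    by rewrite yE => <-.
  exists 0; rewrite linear0; have := ii _ _ iz => /(congr1 (prr n)).
  by rewrite dsK linear0.
have [||e eE] := FK n _ (p n w); first by lia.
  by apply: chmap_cocycle.
have [e' e'E] := sp _ e.
have [|u uE] := ex n (w - cdiff (sval E) (n - 1) n e').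
  by rewrite homB chmapE e'E eE subrr.
exists (prr n u); first exact: stalk_diff.
have uE' : dinr n (prr n u) = u.
  rewrite [u in RHS]dsum_decomp; have -> : prl n u = 0; last by rewrite linear0 add0r.
  by apply: dim0_eq0; apply: dim_stalk0; lia.
rewrite chmap_compE uE'.
by rewrite uE opprB addrC subrK; apply: coboundary_diff.
Qed.

End Obstruction.

Theorem theorem1p2 (k : fieldType) :
  [/\ hom_finite (evenCh k),
      weakly_idempotent_complete (evenCh k),
      is_frobenius (@evenCh_conf k)
    & ~ idempotent_complete (evenCh k)] /\
  [/\ complete_ideal_cotorsion_pair (@evenCh_conf k)
        (ideal_gen (@classF k)) (ideal_gen (@classC k)),
      is_object_ideal (ideal_gen (@classF k)),
      is_object_ideal (ideal_gen (@classC k)),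
      obj_class_eq (Ob (ideal_gen (@classF k))) (@classF k)
    & obj_class_eq (Ob (ideal_gen (@classC k))) (@classC k)] /\
  [/\ cotorsion_pair (@evenCh_conf k) (@classF k) (@classC k),
      ~ special_precovering (@evenCh_conf k) (@classF k) (@classC k)
    & ~ special_preenveloping (@evenCh_conf k) (@classF k) (@classC k)] /\
  (exists M_even : even_betti (objM k),
     ~ has_special_precover (@evenCh_conf k) (@classF k) (@classC k)
         (exist _ (objM k) M_even) /\
     ~ has_special_preenvelope (@evenCh_conf k) (@classF k) (@classC k)
         (exist _ (objM k) M_even)).
Proof.
split; [split | split; [split | split; [split | exists (objM_even k)]]].
- exact: evenCh_hom_finite.
- exact: evenCh_weakly_idempotent.
- exact: evenCh_frobenius.
- exact: evenCh_not_idempotent.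
- exact: complete_FC.
- exact: object_ideal_gen (@idealF k) (@Ob_F k).
- exact: object_ideal_gen (@idealC k) (@Ob_C k).
- exact: Ob_F.
- exact: Ob_C.
- exact: cotorsion_FC.
- by move/(_ (exist _ (objM k) (objM_even k))); apply: no_special_precover.
- by move/(_ (exist _ (objM k) (objM_even k))); apply: no_special_preenvelope.
- by split; [apply: no_special_precover | apply: no_special_preenvelope].
Qed.
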